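(* Let $\lambda$ be an uncountable cardinal, and suppose $\kappa$ is the least $\lambda$-strongly compact cardinal and $\kappa$ has cofinality $\delta$. Then $\delta$ is $\lambda$-measurable; namely, $\delta$ carries a $\lambda$-complete uniform ultrafilter over $\delta$.
   Context: Work in ZFC. ''Definable'' means definable with parameters. Let $\delta\ge\lambda$ be uncountable cardinals. For $\alpha\ge\delta$, $\delta$ is *$\lambda$-strongly compact up to $\alpha$* if there is a definable elementary embedding $j:V\to M$ with $M$ transitive such that $\mathrm{crit}(j)\ge\lambda$ and there is $D\in M$ with $j''\alpha\subseteq D$ and $M\models|D|<j(\delta)$. $\delta$ is *$\lambda$-strongly compact* if it is $\lambda$-strongly compact up to $\alpha$ for every $\alpha\ge\delta$. $\delta$ is *$\lambda$-measurable* if it is $\lambda$-strongly compact up to $\delta$. An ultrafilter $U$ over $\delta$ is *uniform* if every $A\in U$ has cardinality $\delta$. *)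

(* Defs.v *)
Set Implicit Arguments.
Unset Strict Implicit.

(* The universe of sets is an arbitrary model of first-order ZFC.  Formulas
   are deeply embedded, so that the axiom schemas, definability with
   parameters and elementarity have their first-order meaning. *)

Record structure := Structure {
  carrier :> Type;
  mem : carrier -> carrier -> Prop
}.

Arguments mem {s} x y.
Notation "x ∈ y" := (mem x y) (at level 70, no associativity).

(* de Bruijn indices: a quantifier binds variable 0 *)
Inductive formula : Type :=
| FMem (m n : nat)
| FEq (m n : nat)
| FFalse
| FAnd (p q : formula)
| FOr (p q : formula)
| FImp (p q : formula)
| FAll (p : formula)
| FEx (p : formula).

Definition scons {A : Type} (x : A) (e : nat -> A) (n : nat) : A :=
  match n with 0 => x | S m => e m end.

Fixpoint sat (V : structure) (e : nat -> V) (p : formula) : Prop :=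
  match p with
  | FMem m n => e m ∈ e n
  | FEq m n => e m = e n
  | FFalse => False
  | FAnd p q => sat e p /\ sat e q
  | FOr p q => sat e p \/ sat e q
  | FImp p q => sat e p -> sat e q
  | FAll p => forall x : V, sat (scons x e) p
  | FEx p => exists x : V, sat (scons x e) p
  end.

(* Parameters come from the assignment [e]: only its finitely many values at
   the free variables of the formula matter. *)
Definition definable1 (V : structure) (P : V -> Prop) : Prop :=
  exists (p : formula) (e : nat -> V), forall x, P x <-> sat (scons x e) p.

Definition definable2 (V : structure) (R : V -> V -> Prop) : Prop :=
  exists (p : formula) (e : nat -> V),
    forall x y, R x y <-> sat (scons x (scons y e)) p.

Definition submodel (V : structure) (M : V -> Prop) : structure :=
  @Structure {x : V | M x} (fun x y => proj1_sig x ∈ proj1_sig y).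

(* The notions below make sense in every structure, so that "M satisfies ..."
   is the same notion taken in [submodel M]. *)
Section Notions.

Variable V : structure.
Implicit Types a b c d e f x y z u v w p : V.

Definition subset a b : Prop := forall x, x ∈ a -> x ∈ b.
Definition is_empty a : Prop := forall x, ~ x ∈ a.
Definition is_upair p x y : Prop := forall z, z ∈ p <-> z = x \/ z = y.
Definition is_succ a b : Prop := forall z, z ∈ a <-> z ∈ b \/ z = b.

Definition is_opair p x y : Prop :=
  exists u v, is_upair u x x /\ is_upair v x y /\ is_upair p u v.

Record ZFC : Prop := {
  zfc_extensionality : forall x y, (forall z, z ∈ x <-> z ∈ y) -> x = y;
  zfc_foundation : forall x, (exists y, y ∈ x) ->
    exists y, y ∈ x /\ forall z, z ∈ y -> ~ z ∈ x;
  zfc_pairing : forall x y, exists p, is_upair p x y;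
  zfc_union : forall a, exists b, forall x, x ∈ b <-> exists y, y ∈ a /\ x ∈ y;
  zfc_powerset : forall a, exists b, forall x, x ∈ b <-> subset x a;
  zfc_infinity : exists a, (exists x, is_empty x /\ x ∈ a) /\
    forall x, x ∈ a -> exists y, is_succ y x /\ y ∈ a;
  zfc_separation : forall P : V -> Prop, definable1 P ->
    forall a, exists b, forall x, x ∈ b <-> x ∈ a /\ P x;
  zfc_replacement : forall R : V -> V -> Prop, definable2 R ->
    forall a,
      (forall x y z, x ∈ a -> R x y -> R x z -> y = z) ->
      exists b, forall y, y ∈ b <-> exists x, x ∈ a /\ R x y;
  zfc_choice : forall a,
    (forall x, x ∈ a -> exists y, y ∈ x) ->
    (forall x y z, x ∈ a -> y ∈ a -> z ∈ x -> z ∈ y -> x = y) ->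
    exists c, forall x, x ∈ a -> exists! y, y ∈ x /\ y ∈ c
}.

(* In the presence of foundation, the usual von Neumann ordinals. *)
Definition transitive_set a : Prop := forall x, x ∈ a -> subset x a.
Definition ordinal a : Prop :=
  transitive_set a /\ forall x, x ∈ a -> transitive_set x.

(* meant for ordinals *)
Definition ord_le a b : Prop := a ∈ b \/ a = b.

Definition limit_ordinal a : Prop :=
  ordinal a /\ (exists x, x ∈ a) /\
  forall x, x ∈ a -> exists y, is_succ y x /\ y ∈ a.

Definition is_omega w : Prop :=
  limit_ordinal w /\ forall x, x ∈ w -> ~ limit_ordinal x.

Definition maps f x y : Prop := exists p, is_opair p x y /\ p ∈ f.

Definition is_function f a b : Prop :=
  (forall p, p ∈ f -> exists x y, x ∈ a /\ y ∈ b /\ is_opair p x y) /\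
  (forall x, x ∈ a -> exists! y, maps f x y).

Definition is_bijection f a b : Prop :=
  is_function f a b /\ forall y, y ∈ b -> exists! x, maps f x y.

Definition equinumerous a b : Prop := exists f, is_bijection f a b.

Definition cardinal a : Prop :=
  ordinal a /\ forall b, b ∈ a -> ~ equinumerous b a.

(* [c] is the cardinality |a| of [a] *)
Definition has_cardinality a c : Prop := cardinal c /\ equinumerous a c.

(* |a| < c, for a cardinal [c] *)
Definition card_lt a c : Prop := exists d, has_cardinality a d /\ d ∈ c.

Definition uncountable_cardinal a : Prop :=
  cardinal a /\ exists w, is_omega w /\ w ∈ a.

(* [f] maps [d] cofinally into the ordinal [a] *)
Definition cofinal_map f d a : Prop :=
  is_function f d a /\
  forall y, y ∈ a -> exists x z, x ∈ d /\ maps f x z /\ ord_le y z.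

Definition has_cofinality a d : Prop :=
  ordinal d /\ (exists f, cofinal_map f d a) /\
  forall b, b ∈ d -> ~ exists f, cofinal_map f b a.

Definition ultrafilter_over d u : Prop :=
  (forall a, a ∈ u -> subset a d) /\
  d ∈ u /\
  (forall a, is_empty a -> ~ a ∈ u) /\
  (forall a b, a ∈ u -> subset a b -> subset b d -> b ∈ u) /\
  (forall a b c, a ∈ u -> b ∈ u ->
     (forall x, x ∈ c <-> x ∈ a /\ x ∈ b) -> c ∈ u) /\
  (forall a b, subset a d -> (forall x, x ∈ b <-> x ∈ d /\ ~ x ∈ a) ->
     a ∈ u \/ b ∈ u).

(* [u] is closed under intersections of fewer than [l] of its members *)
Definition complete_over l d u : Prop :=
  forall s, subset s u -> card_lt s l ->
  forall b, (forall x, x ∈ b <-> x ∈ d /\ forall a, a ∈ s -> x ∈ a) -> b ∈ u.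

Definition uniform_over d u : Prop :=
  forall a, a ∈ u -> has_cardinality a d.

Definition transitive_class (M : V -> Prop) : Prop :=
  forall x y, M x -> y ∈ x -> M y.

End Notions.

Section Embedding.

Variables (V : structure) (M : V -> Prop) (j : V -> submodel M).

Definition elementary : Prop :=
  forall (p : formula) (e : nat -> V),
    sat e p <-> sat (fun n => j (e n)) p.

Definition definable_embedding : Prop :=
  definable1 M /\ definable2 (fun x y => proj1_sig (j x) = y) /\ elementary.

Definition critical_point (c : V) : Prop :=
  ordinal c /\ proj1_sig (j c) <> c /\
  forall x, x ∈ c -> proj1_sig (j x) = x.

End Embedding.

Section Compactness.

Variable V : structure.

(* [d] is [l]-strongly compact up to [a] *)
Definition strongly_compact_up_to (l d a : V) : Prop :=
  uncountable_cardinal l /\ uncountable_cardinal d /\ ord_le l d /\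
  ordinal a /\ ord_le d a /\
  exists (M : V -> Prop) (j : V -> submodel M),
    transitive_class M /\ definable_embedding j /\
    (exists c, critical_point j c /\ ord_le l c) /\
    exists D : submodel M,
      (forall x, x ∈ a -> j x ∈ D) /\ card_lt D (j d).

Definition strongly_compact (l d : V) : Prop :=
  uncountable_cardinal l /\ uncountable_cardinal d /\ ord_le l d /\
  forall a, ordinal a -> ord_le d a -> strongly_compact_up_to l d a.

Definition measurable (l d : V) : Prop := strongly_compact_up_to l d d.

Definition least_strongly_compact (l k : V) : Prop :=
  strongly_compact l k /\ forall d, strongly_compact l d -> ord_le k d.

End Compactness.

Arguments ZFC V : clear implicits.

(* Main.v *)
Require Import Defs.
From Stdlib Require Import ClassicalEpsilon ProofIrrelevance Arith Lia.

Set Implicit Arguments.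
Unset Strict Implicit.

(* Let j : V -> M be definable with critical point at least lambda.  If some b in j(delta)
   bounds the pointwise image of delta, then D := b witnesses that delta is
   lambda-measurable, and {A : b in j(A)} is a lambda-complete ultrafilter over delta,
   uniform because delta is regular.  So suppose that there is no such j and b, and let
   j, D witness that kappa is lambda-strongly compact up to alpha.

   If delta = kappa, then j(kappa) is regular in M, so D is bounded in j(kappa), a
   contradiction.  If delta < kappa, then kappa is a limit of cardinals (as gamma x gamma
   injects into gamma for infinite gamma) and, j being continuous at delta, |D| < j(xi)
   for some cardinal xi < kappa above lambda; so D yields a lambda-complete ultrafilter on
   sets of size < xi concentrating on the sets that contain any given b < alpha.  The
   existence of such an ultrafilter is a first-order property of xi and alpha, so
   replacement gives one xi < kappa that has it for all alpha.  The ultrapowers by these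
   ultrafilters make xi lambda-strongly compact, against the minimality of kappa. *)

(** * Definability *)

(** The universe is an arbitrary model, so comprehension holds only for classes given by a formula;
    many side conditions are definability claims, discharged by a reifying tactic. [submodel M] is
    never shown to satisfy ZFC: a fact about [M] is proved in [V] in relational terms and carried
    over by elementarity of [j].

    Why a bound is the pivot: without one, the pointwise image of delta is unbounded in j(delta),
    and a monotone cofinal map from delta to kappa, moved by j, makes the image of kappa unbounded
    in j(kappa). This puts the M-cardinality of D below some j(y) with y < kappa. The same fact
    yields lambda < kappa: if they were equal, j(kappa) would consist of fixed ordinals below kappa,
    all of them in D, although |D| < j(kappa).

    Minimality of kappa is contradicted by one xi good for all alpha, while each alpha only yields
    its own xi. Covering passes to smaller alpha; so if every xi < kappa failed somewhere, an
    ordinal above one failure of each xi would be left without any xi. *)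

Lemma sat_ext (V : structure) (p : formula) : forall e e' : nat -> V,
  (forall n, e n = e' n) -> (sat e p <-> sat e' p).
Proof.
  induction p; simpl; intros e e' H.
  - rewrite !H; tauto.
  - rewrite !H; tauto.
  - tauto.
  - rewrite (IHp1 _ _ H), (IHp2 _ _ H); tauto.
  - rewrite (IHp1 _ _ H), (IHp2 _ _ H); tauto.
  - rewrite (IHp1 _ _ H), (IHp2 _ _ H); tauto.
  - assert (K : forall x n, scons x e n = scons x e' n) by (intros x [|n]; simpl; auto).
    split; intros A x; generalize (A x); apply (IHp _ _ (K x)).
  - assert (K : forall x n, scons x e n = scons x e' n) by (intros x [|n]; simpl; auto).
    split; intros [x A]; exists x; revert A; apply (IHp _ _ (K x)).
Qed.

Definition up (r : nat -> nat) : nat -> nat := scons 0 (fun n => S (r n)).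

Fixpoint rename (r : nat -> nat) (p : formula) : formula :=
  match p with
  | FMem m n => FMem (r m) (r n)
  | FEq m n => FEq (r m) (r n)
  | FFalse => FFalse
  | FAnd p q => FAnd (rename r p) (rename r q)
  | FOr p q => FOr (rename r p) (rename r q)
  | FImp p q => FImp (rename r p) (rename r q)
  | FAll p => FAll (rename (up r) p)
  | FEx p => FEx (rename (up r) p)
  end.

Lemma sat_rename (V : structure) (p : formula) : forall (r : nat -> nat) (e e' : nat -> V),
  (forall n, e (r n) = e' n) -> (sat e' p <-> sat e (rename r p)).
Proof.
  induction p; simpl; intros r e e' H.
  - rewrite !H; tauto.
  - rewrite !H; tauto.
  - tauto.
  - rewrite (IHp1 _ _ _ H), (IHp2 _ _ _ H); tauto.
  - rewrite (IHp1 _ _ _ H), (IHp2 _ _ _ H); tauto.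
  - rewrite (IHp1 _ _ _ H), (IHp2 _ _ _ H); tauto.
  - assert (K : forall x n, scons x e (up r n) = scons x e' n) by (intros x [|n]; simpl; auto).
    split; intros A x; generalize (A x); apply (IHp _ _ _ (K x)).
  - assert (K : forall x n, scons x e (up r n) = scons x e' n) by (intros x [|n]; simpl; auto).
    split; intros [x A]; exists x; revert A; apply (IHp _ _ _ (K x)).
Qed.

(* Interleaving two assignments lets one formula use the parameters of two others. *)
Fixpoint mix {A : Type} (a b : nat -> A) (n : nat) : A :=
  match n with 0 => a 0 | S m => mix b (fun k => a (S k)) m end.

Fixpoint evens (n : nat) : nat := match n with 0 => 0 | S m => S (S (evens m)) end.

Lemma mix_evens (A : Type) n : forall a b : nat -> A, mix a b (evens n) = a n.
Proof. induction n; intros a b; simpl; auto. Qed.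

Lemma mix_odds (A : Type) n (a b : nat -> A) : mix a b (S (evens n)) = b n.
Proof. simpl. apply mix_evens. Qed.

(** Renamings that find the parameters of another formula inside a larger assignment: past one bound
    variable, or in the odd half of a [mix]. *)
Definition skip1 (k : nat -> nat) : nat -> nat := fun n => S (k n).
Definition odds (k : nat -> nat) : nat -> nat := fun n => S (evens (k n)).

(** * Rules that build a formula along the connectives of a proposition *)

Section Reify.
Variable V : structure.
Implicit Types (P Q R : Prop) (E : nat -> V).

Lemma rf_mem E m n a b : E m = a -> E n = b -> (a ∈ b <-> sat E (FMem m n)).
Proof. intros <- <-; simpl; tauto. Qed.
Lemma rf_eq E m n a b : E m = a -> E n = b -> (a = b <-> sat E (FEq m n)).
Proof. intros <- <-; simpl; tauto. Qed.
Lemma rf_false E : False <-> sat E FFalse.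
Proof. simpl; tauto. Qed.
Lemma rf_and E P Q p q : (P <-> sat E p) -> (Q <-> sat E q) -> (P /\ Q <-> sat E (FAnd p q)).
Proof. simpl; tauto. Qed.
Lemma rf_or E P Q p q : (P <-> sat E p) -> (Q <-> sat E q) -> (P \/ Q <-> sat E (FOr p q)).
Proof. simpl; tauto. Qed.
Lemma rf_imp E P Q p q : (P <-> sat E p) -> (Q <-> sat E q) -> ((P -> Q) <-> sat E (FImp p q)).
Proof. simpl; tauto. Qed.
Lemma rf_not E P p : (P <-> sat E p) -> (~ P <-> sat E (FImp p FFalse)).
Proof. simpl; tauto. Qed.
Lemma rf_iff E P Q p q : (P <-> sat E p) -> (Q <-> sat E q) ->
  ((P <-> Q) <-> sat E (FAnd (FImp p q) (FImp q p))).
Proof. simpl; tauto. Qed.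
Lemma rf_all E (P : V -> Prop) p : (forall x, P x <-> sat (scons x E) p) ->
  ((forall x, P x) <-> sat E (FAll p)).
Proof. simpl; intros H; split; intros K x; apply H; auto. Qed.
Lemma rf_ex E (P : V -> Prop) p : (forall x, P x <-> sat (scons x E) p) ->
  ((exists x, P x) <-> sat E (FEx p)).
Proof. simpl; intros H; split; intros [x K]; exists x; apply H; auto. Qed.
(** The language has no function symbols: a term inside an atom is named by a quantified variable
    and described by its defining formula. *)
Lemma rf_term E (P : V -> Prop) t p q : (forall y, y = t <-> sat (scons y E) p) ->
  (forall y, P y <-> sat (scons y E) q) -> (P t <-> sat E (FEx (FAnd p q))).
Proof.
  simpl; intros H K; split.
  - intros A; exists t; split; [apply H | apply K]; auto.
  - intros (y & A & B); apply H in A; apply K in B; subst; auto.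
Qed.
Lemma rf_eq_sym (a b : V) P : (b = a <-> P) -> (a = b <-> P).
Proof. intros H; rewrite <- H; split; auto. Qed.
Lemma rf_trans P Q R : (P <-> Q) -> (Q <-> R) -> (P <-> R).
Proof. tauto. Qed.

Lemma lk_here (x : V) r : scons x r 0 = x.
Proof. auto. Qed.
Lemma lk_skip (x a : V) r m : r m = a -> scons x r (S m) = a.
Proof. auto. Qed.
Lemma lk_mix (a : V) e r m : r m = a -> mix e r (S (evens m)) = a.
Proof. intros <-; apply mix_odds. Qed.

Lemma le_scons E E1 s m k : E m = s -> (forall n, E (k n) = E1 n) ->
  forall n, E (scons m k n) = scons s E1 n.
Proof. intros H K [|n]; simpl; auto. Qed.
Lemma le_skip (x : V) r e k : (forall n, r (k n) = e n) -> forall n, scons x r (skip1 k n) = e n.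
Proof. intros H n; simpl; auto. Qed.
Lemma le_mixl (e r : nat -> V) : forall n, mix e r (evens n) = e n.
Proof. intros n; apply mix_evens. Qed.
Lemma le_mixr (e0 r e : nat -> V) k :
  (forall n, r (k n) = e n) -> forall n, mix e0 r (odds k n) = e n.
Proof. intros H n; unfold odds; rewrite mix_odds; auto. Qed.
End Reify.

(* [fomem] collects descriptions of the elements of a term, [foext] reductions of equations to
   formulas, [fo] the notions to unfold. *)
Create HintDb fomem.
Create HintDb foext.
Create HintDb fo.
#[global] Hint Unfold subset is_empty is_upair is_succ is_opair transitive_set ordinal ord_le
  limit_ordinal is_omega maps is_function is_bijection equinumerous cardinal has_cardinality
  card_lt uncountable_cardinal cofinal_map has_cofinality ultrafilter_over complete_over
  uniform_over unique : fo.

(** Finds the de Bruijn index of a value. On reaching a tail that is still unknown, it puts the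
    value there as a new parameter. *)
Ltac lookup :=
  lazymatch goal with
  | |- scons ?x ?r ?m = ?a =>
      tryif constr_eq x a then exact (lk_here x r) else (eapply lk_skip; lookup)
  | |- mix ?e ?r ?m = ?a => eapply lk_mix; lookup
  | |- ?e ?m = ?a =>
      tryif is_evar e
      then (let T := type of a in
            let e' := open_constr:(_ : nat -> T) in
            unify e (@scons T a e'); exact (lk_here a _))
      else (lazymatch a with e ?n => exact (eq_refl (e n)) end)
  end.

(** Locates a whole parameter assignment; an unknown tail is made to contain it by interleaving. *)
Ltac lookup_env :=
  lazymatch goal with
  | |- forall n, scons ?x ?r (?k n) = ?E n => eapply le_skip; lookup_env
  | |- forall n, mix ?e ?r (?k n) = ?E n =>
      tryif constr_eq e E then exact (le_mixl e r) else (eapply le_mixr; lookup_env)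
  | |- forall n, ?e (?k n) = ?E n =>
      let T := type of E in
      let e' := open_constr:(_ : T) in
      unify e (mix E e'); exact (le_mixl E _)
  end.

Ltac lookup_params :=
  lazymatch goal with
  | |- forall n, _ (_ n) = scons _ _ n => eapply le_scons; [lookup | lookup_params]
  | _ => lookup_env
  end.

(* Reifies an atom by means of a definability hypothesis [forall x .., R x .. <-> sat _ p0]. *)
Ltac fo_hyp :=
  match goal with
  | H : context [sat _ ?p0] |- _ <-> sat _ _ =>
      is_var p0;
      eapply rf_trans; [eapply H | eapply sat_rename; solve [lookup_params]]
  end.

(* Proves [P <-> sat E ?p] by building [?p] along the structure of [P].  A free
   tail of [E] is an existential variable to which parameters are added on demand. *)
Ltac fo :=
  lazymatch goal with
  | |- (_ /\ _) <-> _ => eapply rf_and; fo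
  | |- (_ \/ _) <-> _ => eapply rf_or; fo
  | |- (_ <-> _) <-> _ => eapply rf_iff; fo
  | |- False <-> _ => eapply rf_false
  | |- (~ _) <-> _ => eapply rf_not; fo
  | |- (exists _, _) <-> _ => eapply rf_ex; intro; cbv beta; fo
  | |- (?A -> _) <-> _ =>
      lazymatch type of A with
      | Prop => eapply rf_imp; fo
      | _ => eapply rf_all; intro; cbv beta; fo
      end
  | |- (forall _, _) <-> _ => eapply rf_all; intro; cbv beta; fo
  | |- (?a ∈ ?b) <-> _ =>
      first [ eapply rf_mem; lookup
            | fo_hyp
            | eapply rf_trans; [solve [eauto 2 with fomem nocore] | cbv beta; fo]
            | fo_abstract (fun z => z ∈ b) a
            | fo_abstract (fun z => a ∈ z) b ]
  | |- (?a = ?b) <-> _ =>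
      first [ eapply rf_eq; lookup
            | fo_hyp
            | fo_equation a b
            | eapply rf_eq_sym; first [ fo_hyp | fo_equation b a ]
            | fo_abstract (fun z => z = b) a ]
  | |- ?P <-> _ =>
      first [ fo_hyp
            | progress (autounfold with fo; cbv beta); fo
            | lazymatch P with ?R ?s => fo_abstract (fun z => R z) s end
            | lazymatch P with ?R ?s ?t => fo_abstract (fun z => R z t) s end
            | lazymatch P with ?R ?s ?t ?u => fo_abstract (fun z => R z t u) s end ]
  end
with fo_abstract P t :=
  assert_fails (is_var t); eapply (rf_term (P := P) (t := t)); intro; cbv beta; fo
with fo_equation a b :=
  assert_fails (is_var b);
  first [ eapply rf_trans; [solve [eauto 2 with foext nocore] | cbv beta; fo]
        | lazymatch b with ?h ?t => fo_abstract (fun z => a = h z) t end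
        | lazymatch b with ?h ?t ?u => fo_abstract (fun z => a = h z u) t end ].

Definition definable3 (V : structure) (R : V -> V -> V -> Prop) : Prop :=
  exists (p : formula) (e : nat -> V),
    forall x y z, R x y z <-> sat (scons x (scons y (scons z e))) p.

Ltac destruct_defs :=
  repeat match goal with
  | H : definable1 _ |- _ => destruct H as (? & ? & H)
  | H : definable2 _ |- _ => destruct H as (? & ? & H)
  | H : definable3 _ |- _ => destruct H as (? & ? & H)
  end; cbv beta.

Definition inhabitant (V : structure) (hV : ZFC V) : V :=
  proj1_sig (constructive_indefinite_description _
    (match zfc_infinity hV with ex_intro _ a _ => ex_intro (fun _ => True) a I end)).

(** Once every parameter is placed, the rest of the tail is irrelevant and a constant assignment
    fills it. *)
Ltac close_env :=
  match goal with
  | x : carrier ?V |- nat -> carrier ?V => exact (fun _ => x)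
  | H : ZFC ?V |- nat -> carrier ?V => exact (fun _ => inhabitant H)
  end.

(* Other hypotheses could send the proof search astray. *)
Ltac clear_props :=
  repeat match goal with
  | H : ?P |- _ =>
      lazymatch type of P with
      | Prop => lazymatch P with
                | ZFC _ => fail
                | context [sat] => fail
                | _ => clear H
                end
      end
  end.

Ltac def :=
  intros; destruct_defs; clear_props;
  unshelve (eexists; eexists; intros; cbv beta; fo); close_env.

(** * Set operations *)

Section Sets.
Variables (V : structure) (hV : ZFC V).
Implicit Types a b c d f g p s x y z : V.

Lemma ext x y : (forall z, z ∈ x <-> z ∈ y) -> x = y.
Proof. apply (zfc_extensionality hV). Qed.

Lemma ext_iff x y : x = y <-> forall z, z ∈ x <-> z ∈ y.
Proof. split; [intros ->; tauto | apply ext]. Qed.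

(* Junk unless the class [P] is a set. *)
Definition setof (P : V -> Prop) : V :=
  epsilon (inhabits (inhabitant hV)) (fun s => forall x, x ∈ s <-> P x).

Lemma mem_setof (P : V -> Prop) : (exists s, forall x, x ∈ s <-> P x) ->
  forall x, x ∈ setof P <-> P x.
Proof. intros H; apply (epsilon_spec _ (fun s => forall x, x ∈ s <-> P x) H). Qed.

Definition sep a (P : V -> Prop) := setof (fun x => x ∈ a /\ P x).
Lemma mem_sep a (P : V -> Prop) : definable1 P -> forall x, x ∈ sep a P <-> x ∈ a /\ P x.
Proof. intros H; apply mem_setof, (zfc_separation hV H a). Qed.

Definition empty := sep (inhabitant hV) (fun _ => False).
Lemma mem_empty x : x ∈ empty <-> False.
Proof.
  unfold empty; rewrite mem_sep; [tauto |].
  exists FFalse, (fun _ => inhabitant hV); simpl; tauto.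
Qed.

Definition upair a b := setof (fun x => x = a \/ x = b).
Lemma mem_upair a b x : x ∈ upair a b <-> x = a \/ x = b.
Proof. apply mem_setof, (zfc_pairing hV). Qed.

Definition sing a := upair a a.
Lemma mem_sing a x : x ∈ sing a <-> x = a.
Proof. unfold sing; rewrite mem_upair; tauto. Qed.

Definition bigcup a := setof (fun x => exists y, y ∈ a /\ x ∈ y).
Lemma mem_bigcup a x : x ∈ bigcup a <-> exists y, y ∈ a /\ x ∈ y.
Proof. revert x; apply mem_setof, (zfc_union hV). Qed.

Definition cup a b := bigcup (upair a b).
Lemma mem_cup a b x : x ∈ cup a b <-> x ∈ a \/ x ∈ b.
Proof.
  unfold cup; rewrite mem_bigcup; split.
  - intros (y & H & K); apply mem_upair in H; destruct H; subst; auto.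
  - intros [H | H]; [exists a | exists b]; rewrite mem_upair; auto.
Qed.

Definition succ a := cup a (sing a).
Lemma mem_succ a x : x ∈ succ a <-> x ∈ a \/ x = a.
Proof. unfold succ; rewrite mem_cup, mem_sing; tauto. Qed.

Lemma is_succ_iff a b : is_succ a b <-> a = succ b.
Proof. rewrite ext_iff; unfold is_succ; split; intros H z; generalize (H z); rewrite mem_succ; tauto. Qed.

Definition power a := setof (fun x => subset x a).
Lemma mem_power a x : x ∈ power a <-> subset x a.
Proof. revert x; apply mem_setof, (zfc_powerset hV). Qed.

Definition opair x y := upair (sing x) (upair x y).
Lemma mem_opair x y z : z ∈ opair x y <-> z = sing x \/ z = upair x y.
Proof. apply mem_upair. Qed.

Lemma is_upair_iff p x y : is_upair p x y <-> p = upair x y.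
Proof. rewrite ext_iff; unfold is_upair; split; intros H z; generalize (H z); rewrite mem_upair; tauto. Qed.

Lemma is_opair_iff p x y : is_opair p x y <-> p = opair x y.
Proof.
  unfold is_opair; split.
  - intros (u & v & A & B & C); rewrite is_upair_iff in A, B, C; subst; auto.
  - intros ->; exists (sing x), (upair x y); rewrite !is_upair_iff; auto.
Qed.

Lemma opair_iff p x y : p = opair x y <-> is_opair p x y.
Proof. symmetry; apply is_opair_iff. Qed.

Lemma upair_inj x y z : upair x y = upair x z -> y = z.
Proof.
  intros H; assert (A := mem_upair x y z); assert (B := mem_upair x z y).
  rewrite H, mem_upair in A; rewrite <- H, mem_upair in B.
  destruct A as [A _]; destruct B as [B _].
  destruct A as [A | A]; auto; destruct B as [B | B]; subst; auto.
Qed.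

Lemma opair_inj x y x' y' : opair x y = opair x' y' -> x = x' /\ y = y'.
Proof.
  intros H.
  assert (E : x = x').
  { assert (A : sing x ∈ opair x' y') by (rewrite <- H, mem_opair; auto).
    apply mem_opair in A.
    assert (B : x' ∈ sing x) by (destruct A as [-> | ->]; apply mem_upair; auto).
    symmetry; apply mem_sing; auto. }
  subst x'; split; auto; apply upair_inj in H; apply upair_inj in H; auto.
Qed.

Lemma maps_iff f x y : maps f x y <-> opair x y ∈ f.
Proof.
  unfold maps; split.
  - intros (p & A & B); apply is_opair_iff in A; subst; auto.
  - exists (opair x y); rewrite is_opair_iff; auto.
Qed.

Lemma opair_mem f x y : opair x y ∈ f <-> maps f x y.
Proof. symmetry; apply maps_iff. Qed.

Definition repl a (F : V -> V) := setof (fun y => exists x, x ∈ a /\ y = F x).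
Lemma mem_repl a F : definable2 (fun x y => y = F x) ->
  forall y, y ∈ repl a F <-> exists x, x ∈ a /\ y = F x.
Proof.
  intros H; apply mem_setof; apply (zfc_replacement hV H).
  intros x y z _ -> ->; auto.
Qed.

(* [f] is total as a function symbol: off its domain the value is empty. *)
Definition app f x := setof (fun z => exists y, z ∈ y /\ opair x y ∈ f).
End Sets.

#[global] Hint Resolve mem_empty mem_upair mem_sing mem_bigcup mem_cup mem_succ mem_power
  mem_opair opair_mem : fomem.
#[global] Hint Resolve opair_iff ext_iff : foext.

Section Functions.
Variables (V : structure) (hV : ZFC V).
Implicit Types a b c d f g p s x y z : V.
Local Notation opair := (opair hV).
Local Notation app := (app hV).

Lemma mem_app f x z : z ∈ app f x <-> exists y, z ∈ y /\ opair x y ∈ f.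
Proof.
  revert z; apply mem_setof.
  (* In z ∈ y ∈ {x, y} ∈ [opair x y] ∈ [f], three unions of [f] reach [z]. *)
  set (B := sep hV (bigcup hV (bigcup hV (bigcup hV f)))
    (fun z => exists y, z ∈ y /\ opair x y ∈ f)).
  exists B; intros z; unfold B; rewrite mem_sep by def.
  split; [tauto |]; intros H; split; auto; destruct H as (y & A & C).
  apply mem_bigcup; exists y; split; auto.
  apply mem_bigcup; exists (upair hV x y); split; [| apply mem_upair; auto].
  apply mem_bigcup; exists (opair x y); split; auto; apply mem_opair; auto.
Qed.

Lemma app_eq f x y : opair x y ∈ f -> (forall y', opair x y' ∈ f -> y' = y) -> app f x = y.
Proof.
  intros H K; apply (ext hV); intros z; rewrite mem_app; split.
  - intros (y' & A & B); rewrite <- (K _ B); auto.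
  - exists y; auto.
Qed.
End Functions.

#[global] Hint Resolve mem_app : fomem.

Section Functions2.
Variables (V : structure) (hV : ZFC V).
Implicit Types a b c d f g h p s x y z : V.
Local Notation opair := (opair hV).
Local Notation app := (app hV).

Definition lam a (F : V -> V) := repl hV a (fun x => opair x (F x)).

Lemma mem_lam a F : definable2 (fun x y => y = F x) ->
  forall p, p ∈ lam a F <-> exists x, x ∈ a /\ p = opair x (F x).
Proof. intros H; apply mem_repl; def. Qed.

Lemma opair_lam a F : definable2 (fun x y => y = F x) ->
  forall x y, opair x y ∈ lam a F <-> x ∈ a /\ y = F x.
Proof.
  intros H x y; rewrite mem_lam by auto; split.
  - intros (x' & A & B); apply opair_inj in B; destruct B; subst; auto.
  - intros [A ->]; exists x; auto.
Qed.

Lemma app_lam a F x : definable2 (fun x y => y = F x) -> x ∈ a -> app (lam a F) x = F x.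
Proof.
  intros H K; apply app_eq; [apply opair_lam; auto |].
  intros y A; apply opair_lam in A; tauto.
Qed.

Lemma lam_function a b F : definable2 (fun x y => y = F x) ->
  (forall x, x ∈ a -> F x ∈ b) -> is_function (lam a F) a b.
Proof.
  intros H K; split.
  - intros p A; apply mem_lam in A; auto; destruct A as (x & A & ->).
    exists x, (F x); rewrite is_opair_iff; auto.
  - intros x A; exists (F x); split; [apply maps_iff with hV, opair_lam; auto |].
    intros y B; apply (maps_iff hV), opair_lam in B; auto; symmetry; tauto.
Qed.

Lemma function_app f a b x : is_function f a b -> x ∈ a -> app f x ∈ b /\ opair x (app f x) ∈ f.
Proof.
  intros [H1 H2] A; destruct (H2 x A) as (y & B & C).
  apply (maps_iff hV) in B.
  assert (E : app f x = y).
  { apply app_eq; auto; intros y' D; symmetry; apply C, (maps_iff hV); auto. }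
  rewrite E; split; auto.
  destruct (H1 _ B) as (x' & y' & D & F & G); apply (is_opair_iff hV), opair_inj in G.
  destruct G; subst; auto.
Qed.

Lemma function_mem f a b : is_function f a b ->
  forall x y, opair x y ∈ f <-> x ∈ a /\ y = app f x.
Proof.
  intros H x y; split.
  - intros A; destruct H as [H1 H2].
    destruct (H1 _ A) as (x' & y' & D & F & G); apply (is_opair_iff hV), opair_inj in G.
    destruct G; subst x' y'; split; auto.
    destruct (H2 x D) as (z & B & C).
    symmetry; apply app_eq; auto; intros y' K.
    transitivity z; [symmetry |]; apply C, (maps_iff hV); auto.
  - intros [A ->]; eapply function_app; eauto.
Qed.

Lemma function_maps f a b : is_function f a b ->
  forall x y, x ∈ a -> (maps f x y <-> y = app f x).
Proof. intros H x y A; rewrite maps_iff, (function_mem H); tauto. Qed.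

Lemma function_pair f a b p : is_function f a b -> p ∈ f -> exists x, x ∈ a /\ p = opair x (app f x).
Proof.
  intros H A; destruct (proj1 H _ A) as (x & y & B & C & D).
  apply (is_opair_iff hV) in D; subst p.
  apply (function_mem H) in A; destruct A as [_ ->]; eauto.
Qed.

Lemma function_mono f a b c : is_function f a b -> (forall x, x ∈ a -> app f x ∈ c) ->
  is_function f a c.
Proof.
  intros H K; split; [| apply H].
  intros p A; destruct (function_pair H A) as (x & B & ->).
  exists x, (app f x); rewrite is_opair_iff; auto.
Qed.

Definition product a b := sep hV (power hV (power hV (cup hV a b)))
  (fun p => exists x y, x ∈ a /\ y ∈ b /\ p = opair x y).

Lemma mem_prod a b p : p ∈ product a b <-> exists x y, x ∈ a /\ y ∈ b /\ p = opair x y.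
Proof.
  unfold product; rewrite mem_sep by def.
  split; [tauto |]; intros H; split; auto.
  destruct H as (x & y & A & B & ->); apply mem_power; intros u C.
  apply mem_power; intros v D; apply mem_cup.
  apply mem_opair in C; destruct C; subst u;
    [apply mem_sing in D | apply mem_upair in D]; intuition (subst; auto).
Qed.

Lemma opair_prod a b x y : opair x y ∈ product a b <-> x ∈ a /\ y ∈ b.
Proof.
  rewrite mem_prod; split.
  - intros (x' & y' & A & B & C); apply opair_inj in C; destruct C; subst; auto.
  - intros []; exists x, y; auto.
Qed.

Definition funset a b := sep hV (power hV (product a b)) (fun f => is_function f a b).

Lemma mem_funset a b f : f ∈ funset a b <-> is_function f a b.
Proof.
  unfold funset; rewrite mem_sep by def.
  split; [tauto |]; intros H; split; auto; apply mem_power; intros p A.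
  destruct (function_pair H A) as (x & B & ->); apply opair_prod.
  split; auto; apply (function_app H B).
Qed.
End Functions2.

#[global] Hint Resolve mem_prod mem_funset : fomem.

Section Choice.
Variables (V : structure) (hV : ZFC V).
Implicit Types a b c d f g h p s x y z : V.
Local Notation opair := (opair hV).
Local Notation app := (app hV).

Lemma choice_function_bounded a b (R : V -> V -> Prop) : definable2 R ->
  (forall x, x ∈ a -> exists y, y ∈ b /\ R x y) ->
  exists f, is_function f a b /\ forall x, x ∈ a -> R x (app f x).
Proof.
  intros HR H.
  (* Tagging the candidates for [x] with [x] itself makes the family disjoint, as the axiom of
     choice demands. *)
  set (B := fun x => sep hV (product hV (sing hV x) b) (fun p => exists y, R x y /\ p = opair x y)).
  assert (mB : forall x p, p ∈ B x <-> exists y, y ∈ b /\ R x y /\ p = opair x y).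
  { intros x p; unfold B; rewrite mem_sep by def; rewrite mem_prod; split.
    - intros ((x' & y & C & D & ->) & y' & E & F).
      apply mem_sing in C; apply opair_inj in F; destruct F; subst; eauto.
    - intros (y & C & D & ->); split; [exists x, y; rewrite mem_sing |]; eauto. }
  assert (dB : definable2 (fun x y => y = B x)).
  { cut (definable2 (fun x s => forall p, p ∈ s <-> exists y, y ∈ b /\ R x y /\ p = opair x y)).
    - intros (q & e & K); exists q, e; intros x y; rewrite <- K, (ext_iff hV).
      split; intros L p; generalize (L p); rewrite mB; auto.
    - def. }
  destruct (@zfc_choice V hV (repl hV a B)) as [c Hc].
  - intros s A; apply mem_repl in A; auto; destruct A as (x & A & ->).
    destruct (H x A) as (y & C & D); exists (opair x y); apply mB; eauto.
  - intros s s' p A A' C D; apply mem_repl in A; auto; apply mem_repl in A'; auto.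
    destruct A as (x & A & ->); destruct A' as (x' & A' & ->).
    apply mB in C; apply mB in D.
    destruct C as (y & _ & _ & ->); destruct D as (y' & _ & _ & D).
    apply opair_inj in D; destruct D; subst; auto.
  - assert (K : forall x, x ∈ a -> exists y, y ∈ b /\ R x y /\ opair x y ∈ c /\
      forall y', y' ∈ b -> R x y' -> opair x y' ∈ c -> y' = y).
    { intros x A; destruct (Hc (B x)) as (p & (C & D) & E); [apply mem_repl; eauto |].
      apply mB in C; destruct C as (y & C & F & ->); exists y; repeat split; auto.
      intros y' G I J; assert (L : opair x y = opair x y') by (apply E; rewrite mB; eauto).
      apply opair_inj in L; symmetry; tauto. }
    set (f := sep hV (product hV a b) (fun p => p ∈ c /\ exists x y, R x y /\ p = opair x y)).
    assert (mf : forall x y, opair x y ∈ f <-> x ∈ a /\ y ∈ b /\ R x y /\ opair x y ∈ c).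
    { intros x y; unfold f; rewrite mem_sep by def; rewrite opair_prod; split.
      - intros ((A & C) & D & x' & y' & E & F); apply opair_inj in F; destruct F; subst; auto.
      - intros (A & C & D & E); repeat split; eauto. }
    assert (ff : is_function f a b).
    { split.
      - intros p A; assert (C := A); unfold f in A; rewrite mem_sep in A by def; destruct A as [A _].
        apply mem_prod in A; destruct A as (x & y & A & D & ->).
        exists x, y; rewrite is_opair_iff; auto.
      - intros x A; destruct (K x A) as (y & C & D & E & F); exists y; split.
        + apply (maps_iff hV), mf; auto.
        + intros y' G; apply (maps_iff hV), mf in G; symmetry; apply F; tauto. }
    exists f; split; auto; intros x A.
    destruct (function_app hV ff A) as [_ C]; apply mf in C; tauto.
Qed.
End Choice.

(** * Well-founded recursion *)

Section Recursion.
Variables (V : structure) (hV : ZFC V).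
Implicit Types a b c d f g h p s v w x y z X Y : V.
Local Notation opair := (opair hV).
Local Notation app := (app hV).

(** Only sets [Y] are tested, which keeps the notion first-order; induction is then available for
    definable properties, whose counterexamples in [X] form a set. *)
Definition wf_on X (R : V -> V -> Prop) : Prop :=
  forall Y, subset Y X -> (exists y, y ∈ Y) -> exists y, y ∈ Y /\ forall z, z ∈ Y -> ~ R z y.

Lemma wf_ind X (R : V -> V -> Prop) (P : V -> Prop) : wf_on X R -> definable1 P ->
  (forall x, x ∈ X -> (forall y, y ∈ X -> R y x -> P y) -> P x) -> forall x, x ∈ X -> P x.
Proof.
  intros W D H x Hx; apply NNPP; intros N.
  destruct (W (sep hV X (fun x => ~ P x))) as (y & A & B).
  - intros z A; rewrite mem_sep in A by def; tauto.
  - exists x; rewrite mem_sep by def; auto.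
  - rewrite mem_sep in A by def; destruct A as [A C]; apply C, H; auto.
    intros z E F; apply NNPP; intros G; apply (B z); auto; rewrite mem_sep by def; auto.
Qed.

Definition restrict (R : V -> V -> Prop) g x :=
  sep hV g (fun p => exists y w, R y x /\ p = opair y w).

Lemma mem_restrict R g x p : definable2 R ->
  (p ∈ restrict R g x <-> p ∈ g /\ exists y w, R y x /\ p = opair y w).
Proof. intros D; unfold restrict; apply mem_sep; def. Qed.

Lemma opair_restrict R g x y w : definable2 R ->
  (opair y w ∈ restrict R g x <-> opair y w ∈ g /\ R y x).
Proof.
  intros D; rewrite mem_restrict by auto; split; intros [A B]; split; auto.
  - destruct B as (y' & w' & B & C); apply opair_inj in C; destruct C; subst; auto.
  - eauto.
Qed.

Lemma restrict_ext R g g' x : definable2 R ->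
  (forall y w, R y x -> (opair y w ∈ g <-> opair y w ∈ g')) -> restrict R g x = restrict R g' x.
Proof.
  intros D H; apply (ext hV); intros p; rewrite !mem_restrict by auto.
  split; intros (A & y & w & B & ->); split; eauto; apply H; auto.
Qed.

Section Attempts.
Variables (X : V) (R : V -> V -> Prop) (Phi : V -> V -> V -> Prop).

(** A partial solution whose domain is closed under [R]-predecessors. The clause [Phi x g z] says
    that [z] is an element of the value at [x], so recursion rules are given by formulas and not by
    function symbols. *)
Definition attempt g : Prop :=
  (forall p, p ∈ g -> exists x v, x ∈ X /\ p = opair x v) /\
  (forall x v v', opair x v ∈ g -> opair x v' ∈ g -> v = v') /\
  (forall x v y, opair x v ∈ g -> y ∈ X -> R y x -> exists w, opair y w ∈ g) /\
  (forall x v, opair x v ∈ g -> forall z, z ∈ v <-> Phi x (restrict R g x) z).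

(** [Phi] is known only through a formula in variables, so the term [restrict R g x] is first named
    by a bound variable [r]. *)
Lemma attempt_definable : definable2 R -> definable3 Phi -> definable1 attempt.
Proof.
  intros dR dPhi.
  cut (definable1 (fun g =>
   (forall p, p ∈ g -> exists x v, x ∈ X /\ p = opair x v) /\
  (forall x v v', opair x v ∈ g -> opair x v' ∈ g -> v = v') /\
  (forall x v y, opair x v ∈ g -> y ∈ X -> R y x -> exists w, opair y w ∈ g) /\
  (forall x v, opair x v ∈ g -> forall z, z ∈ v <-> exists r,
    (forall p, p ∈ r <-> p ∈ g /\ exists y w, R y x /\ p = opair y w) /\ Phi x r z))).
  - intros (q & e & H); exists q, e; intros g; rewrite <- H; unfold attempt.
    assert (K : forall x z, Phi x (restrict R g x) z <-> exists r,
      (forall p, p ∈ r <-> p ∈ g /\ exists y w, R y x /\ p = opair y w) /\ Phi x r z).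
    { intros x z; split.
      - intros A; exists (restrict R g x); split; auto; intros p; apply mem_restrict; auto.
      - intros (r & A & B); replace (restrict R g x) with r; auto.
        apply (ext hV); intros p; rewrite A, mem_restrict; tauto. }
    split; intros (A & B & C & D); repeat split; auto; intros E.
    + apply K, (D _ _ H0); auto.
    + apply (D _ _ H0), K; auto.
    + apply K, (D _ _ H0); auto.
    + apply (D _ _ H0), K; auto.
  - def.
Qed.

Hypotheses (dR : definable2 R) (dPhi : definable3 Phi) (W : wf_on X R)
  (HPhi : forall x g, exists s, forall z, z ∈ s <-> Phi x g z).

Lemma attempt_dom g x v : attempt g -> opair x v ∈ g -> x ∈ X.
Proof.
  intros (A & _) H; destruct (A _ H) as (x' & v' & B & C).
  apply opair_inj in C; destruct C; subst; auto.
Qed.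

Lemma attempt_unique g g' : attempt g -> attempt g' ->
  forall x, x ∈ X -> forall v v', opair x v ∈ g -> opair x v' ∈ g' -> v = v'.
Proof.
  intros H H'; apply (wf_ind (R := R) (P := fun x => forall v v', opair x v ∈ g -> opair x v' ∈ g' -> v = v')); auto;
    [def |].
  intros x Hx IH v v' A A'; apply (ext hV); intros z.
  destruct H as (H1 & H2 & H3 & H4); destruct H' as (H1' & H2' & H3' & H4').
  rewrite (H4 _ _ A), (H4' _ _ A').
  rewrite (@restrict_ext R g g'); [tauto | auto |].
  intros y w B; split; intros C.
  - assert (D : y ∈ X) by (apply (@attempt_dom g y w); [repeat split; auto; apply H4; auto | auto]).
    destruct (H3' _ _ _ A' D B) as (w' & E); rewrite (IH y D B _ _ C E); auto.
  - assert (D : y ∈ X) by (apply (@attempt_dom g' y w); [repeat split; auto; apply H4'; auto | auto]).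
    destruct (H3 _ _ _ A D B) as (w' & E); rewrite <- (IH y D B _ _ E C); auto.
Qed.

Theorem wf_recursion : exists h,
  (forall p, p ∈ h -> exists x v, p = opair x v) /\
  (forall x v, opair x v ∈ h <-> x ∈ X /\ v = app h x) /\
  forall x, x ∈ X -> forall z, z ∈ app h x <-> Phi x (restrict R h x) z.
Proof.
  assert (dA := attempt_definable dR dPhi).
  set (val := fun x v => exists g, attempt g /\ opair x v ∈ g).
  assert (dval : definable2 val) by (unfold val; def).
  destruct (zfc_replacement hV (R := fun x p => exists v, val x v /\ p = opair x v))
    with (a := X) as [h Hh].
  { def. }
  { intros x p p' Hx (v & (g & A & B) & ->) (v' & (g' & A' & B') & ->).
    rewrite (attempt_unique A A' Hx B B'); auto. }
  assert (hv : forall x v, opair x v ∈ h <-> x ∈ X /\ val x v).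
  { intros x v; rewrite Hh; split.
    - intros (x' & A & v' & B & C); apply opair_inj in C; destruct C; subst; auto.
    - intros [A B]; exists x; split; eauto. }
  assert (Ah : attempt h).
  { split; [| split; [| split]].
    - intros p A; apply Hh in A; destruct A as (x & A & v & B & C); eauto.
    - intros x v v' A B; apply hv in A; apply hv in B.
      destruct A as (Hx & g & A & C); destruct B as (_ & g' & B & D).
      apply (attempt_unique A B Hx C D).
    - intros x v y A Hy B; apply hv in A; destruct A as (Hx & g & A & C).
      destruct (proj1 (proj2 (proj2 A)) _ _ _ C Hy B) as [w D]; exists w; apply hv; split; auto.
      exists g; auto.
    - intros x v A z; apply hv in A; destruct A as (Hx & g & A & C).
      rewrite (proj2 (proj2 (proj2 A)) _ _ C z), (@restrict_ext R g h); [tauto | auto |].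
      intros y w B; rewrite hv; split.
      + intros D; split; [apply (attempt_dom A D) | exists g; auto].
      + intros (Hy & g' & A' & D).
        destruct (proj1 (proj2 (proj2 A)) _ _ _ C Hy B) as [w' E].
        rewrite (attempt_unique A' A Hy D E); auto. }
  assert (tot : forall x, x ∈ X -> exists v, opair x v ∈ h).
  { apply (wf_ind (R := R) (P := fun x => exists v, opair x v ∈ h)); auto; [def |].
    (* If [h] missed [x], adding the value prescribed at [x] would give an attempt defined there,
       because [h] already covers all predecessors of [x]. *)
    intros x Hx IH; apply NNPP; intros N.
    destruct (HPhi x (restrict R h x)) as [v Hv].
    (* Irreflexivity ensures that the added pair does not change the restriction from which the
       value at [x] was computed. *)
    assert (Rxx : ~ R x x).
    { intros Q; destruct (W (Y := sing hV x)) as (y & A & B).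
      - intros y A; apply mem_sing in A; subst; auto.
      - exists x; apply mem_sing; auto.
      - apply mem_sing in A; subst y; apply (B x); auto; apply mem_sing; auto. }
    set (g := cup hV h (sing hV (opair x v))).
    assert (mg : forall y w, opair y w ∈ g <-> opair y w ∈ h \/ y = x /\ w = v).
    { intros y w; unfold g; rewrite mem_cup, mem_sing; split; intros [A | A]; auto.
      - apply opair_inj in A; auto.
      - destruct A; subst; auto. }
    destruct Ah as (A1 & A2 & A3 & A4).
    assert (Ag : attempt g).
    { split; [| split; [| split]].
      - intros p A; unfold g in A; apply mem_cup in A; destruct A as [A | A]; auto.
        apply mem_sing in A; eauto.
      - intros y w w' A B; apply mg in A; apply mg in B.
        destruct A as [A | [-> ->]], B as [B | [B ->]]; subst; eauto; destruct N; eauto.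
      - intros y w y' A Hy B; apply mg in A; destruct A as [A | [-> ->]].
        + destruct (A3 _ _ _ A Hy B) as [w' C]; exists w'; apply mg; auto.
        + destruct (IH _ Hy B) as [w' C]; exists w'; apply mg; auto.
      - intros y w A z; apply mg in A; destruct A as [A | [-> ->]].
        + rewrite (A4 _ _ A), (@restrict_ext R h g); [tauto | auto |].
          intros y' w' B; rewrite mg; split; auto; intros [C | [-> ->]]; auto.
          destruct N; apply (A3 _ _ _ A Hx B).
        + rewrite Hv, (@restrict_ext R h g); [tauto | auto |].
          intros y' w' B; rewrite mg; split; auto; intros [C | [-> ->]]; auto; contradiction. }
    apply N; exists v; apply hv; split; auto; exists g; split; auto; apply mg; auto. }
  assert (ap : forall x v, opair x v ∈ h -> app h x = v).
  { intros x v A; apply app_eq; auto; intros v' B; eapply (proj1 (proj2 Ah)); eauto. }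
  exists h; split; [| split].
  - intros p A; apply (proj1 Ah) in A; destruct A as (x & v & _ & A); eauto.
  - intros x v; split.
    + intros A; split; [apply (attempt_dom Ah A) | symmetry; auto].
    + intros [Hx ->]; destruct (tot x Hx) as [w A]; rewrite (ap _ _ A); auto.
  - intros x Hx; destruct (tot x Hx) as [w A]; rewrite (ap _ _ A).
    apply (proj2 (proj2 (proj2 Ah))); auto.
Qed.
End Attempts.
End Recursion.

(** * Ordinals *)

Section Ordinals.
Variables (V : structure) (hV : ZFC V).
Implicit Types a b c d f g h p s v w x y z X Y : V.

Lemma mem_irrefl x : ~ x ∈ x.
Proof.
  intros H; destruct (@zfc_foundation V hV (sing hV x)) as (y & A & B).
  - exists x; apply mem_sing; auto.
  - apply mem_sing in A; subst; apply (B x); auto; apply mem_sing; auto.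
Qed.

Lemma mem_asym x y : x ∈ y -> ~ y ∈ x.
Proof.
  intros H K; destruct (@zfc_foundation V hV (upair hV x y)) as (z & A & B).
  - exists x; apply mem_upair; auto.
  - apply mem_upair in A; destruct A; subst;
      [apply (B y); auto | apply (B x); auto]; apply mem_upair; auto.
Qed.

Lemma wf_mem X : wf_on X (fun x y => x ∈ y).
Proof.
  intros Y _ H; destruct (zfc_foundation hV H) as (y & A & B); exists y; split; auto.
  intros z C D; apply (B z D C).
Qed.

Lemma ordinal_mem a x : ordinal a -> x ∈ a -> ordinal x.
Proof. intros [H K] A; split; auto; intros y B; apply K, (H x A y B). Qed.

Lemma ordinal_trans a x y : ordinal a -> x ∈ a -> y ∈ x -> y ∈ a.
Proof. intros [H _] A B; apply (H x A y B). Qed.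

Lemma ordinal_ind (P : V -> Prop) : definable1 P ->
  (forall a, ordinal a -> (forall x, x ∈ a -> P x) -> P a) -> forall a, ordinal a -> P a.
Proof.
  intros D H a Ha; apply H; auto.
  apply (wf_ind (X := a) (R := fun x y => x ∈ y) hV (@wf_mem a) D).
  intros x A B; apply H; [apply (ordinal_mem Ha A) |].
  intros y C; apply B; auto; apply (ordinal_trans Ha A C).
Qed.

Lemma ordinal_least (P : V -> Prop) a : definable1 P -> ordinal a -> P a ->
  exists b, ordinal b /\ P b /\ forall x, x ∈ b -> ~ P x.
Proof.
  intros D Ha Pa; apply NNPP; intros N; revert Pa.
  apply (@ordinal_ind (fun a => ~ P a)); auto; [def |].
  intros b Hb K Pb; apply N; exists b; auto.
Qed.

Lemma ordinal_linear a b : ordinal a -> ordinal b -> a ∈ b \/ a = b \/ b ∈ a.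
Proof.
  intros Ha; revert b; revert a Ha.
  apply (@ordinal_ind (fun a => forall b, ordinal b -> a ∈ b \/ a = b \/ b ∈ a)); [def |].
  intros a Ha IHa.
  apply (@ordinal_ind (fun b => a ∈ b \/ a = b \/ b ∈ a)); [def |].
  intros b Hb IHb; apply NNPP; intros N; apply N; right; left; apply (ext hV); intros x; split; intros A.
  - destruct (IHa x A b Hb) as [B | [B | B]]; auto; destruct N; subst; auto.
    right; right; apply (ordinal_trans Ha A B).
  - destruct (IHb x A) as [B | [B | B]]; auto; destruct N; subst; auto.
    left; apply (ordinal_trans Hb A B).
Qed.

Lemma ordinal_le_subset a b : ordinal b -> ord_le a b -> subset a b.
Proof. intros Hb [A | ->] x B; auto; apply (ordinal_trans Hb A B). Qed.

Lemma ordinal_subset_le a b : ordinal a -> ordinal b -> subset a b -> ord_le a b.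
Proof.
  intros Ha Hb S; destruct (ordinal_linear Ha Hb) as [A | [A | A]]; unfold ord_le; auto.
  destruct (mem_irrefl (S _ A)).
Qed.

Lemma ordinal_not_mem a b : ordinal a -> ordinal b -> ~ b ∈ a -> ord_le a b.
Proof. intros Ha Hb N; destruct (ordinal_linear Ha Hb) as [A | [A | A]]; unfold ord_le; tauto. Qed.

Lemma ord_le_mem a b c : ordinal c -> ord_le a b -> b ∈ c -> a ∈ c.
Proof. intros Hc [A | ->] B; auto; apply (ordinal_trans Hc B A). Qed.

Lemma mem_ord_le a b c : ordinal c -> a ∈ b -> ord_le b c -> a ∈ c.
Proof. intros Hc A [B | ->]; auto; apply (ordinal_trans Hc B A). Qed.

Lemma ord_le_trans a b c : ordinal c -> ord_le a b -> ord_le b c -> ord_le a c.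
Proof. intros Hc [A | ->]; auto; intros B; left; apply (mem_ord_le Hc A B). Qed.

Lemma ordinal_succ a : ordinal a -> ordinal (succ hV a).
Proof.
  intros Ha; split.
  - intros x A y B; apply mem_succ; apply mem_succ in A; destruct A as [A | ->]; auto.
    left; apply (ordinal_trans Ha A B).
  - intros x A; apply mem_succ in A; destruct A as [A | ->]; [apply (proj2 Ha _ A) | apply (proj1 Ha)].
Qed.

Lemma ordinal_bigcup s : (forall x, x ∈ s -> ordinal x) -> ordinal (bigcup hV s).
Proof.
  intros H; split.
  - intros x A y B; apply mem_bigcup in A; destruct A as (z & A & C); apply mem_bigcup.
    exists z; split; auto; apply (ordinal_trans (H z A) C B).
  - intros x A; apply mem_bigcup in A; destruct A as (z & A & C); apply (proj2 (H z A) x C).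
Qed.

Lemma ord_le_bigcup s x : (forall x, x ∈ s -> ordinal x) -> x ∈ s -> ord_le x (bigcup hV s).
Proof.
  intros H A; apply ordinal_subset_le; auto; [apply ordinal_bigcup; auto |].
  intros y B; apply mem_bigcup; eauto.
Qed.

Lemma transitive_ordinal a : transitive_set a -> (forall x, x ∈ a -> ordinal x) -> ordinal a.
Proof. intros H K; split; auto; intros x A; apply K, A. Qed.

Lemma ordinal_empty : ordinal (empty hV).
Proof. split; intros x A; apply mem_empty in A; destruct A. Qed.

Lemma is_empty_iff x : is_empty x <-> x = empty hV.
Proof.
  rewrite (ext_iff hV); unfold is_empty; split; intros H z; generalize (H z); rewrite mem_empty; tauto.
Qed.

Lemma ordinal_cases a : ordinal a ->
  a = empty hV \/ (exists b, b ∈ a /\ a = succ hV b) \/ limit_ordinal a.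
Proof.
  intros Ha; apply NNPP; intros N; apply N; right; right; split; [exact Ha | split].
  - apply NNPP; intros K; apply N; left; apply is_empty_iff; intros x A; apply K; eauto.
  - intros x A; exists (succ hV x); rewrite is_succ_iff; split; auto.
    apply NNPP; intros K; apply N; right; left; exists x; split; auto.
    apply ordinal_not_mem in K; auto; [| apply ordinal_succ, (ordinal_mem Ha A)].
    destruct K as [K | K]; auto.
    apply mem_succ in K; destruct K as [K | ->]; [destruct (mem_asym A K) | destruct (mem_irrefl A)].
Qed.

Lemma omega_succ w : is_omega w -> forall x, x ∈ w -> succ hV x ∈ w.
Proof.
  intros [(H & K & L) _] x A; destruct (L x A) as (y & B & C); apply (is_succ_iff hV) in B; subst; auto.
Qed.

Lemma omega_empty w : is_omega w -> empty hV ∈ w.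
Proof.
  intros [(H & K & L) _]; destruct K as [x A].
  assert (B : ord_le (empty hV) w).
  { apply ordinal_subset_le; auto using ordinal_empty; intros y B; apply mem_empty in B; tauto. }
  destruct B as [B | B]; auto; subst; apply mem_empty in A; tauto.
Qed.

Lemma omega_cases w : is_omega w -> forall x, x ∈ w ->
  x = empty hV \/ exists y, y ∈ x /\ x = succ hV y.
Proof.
  intros [(H & K & L) M] x A; destruct (ordinal_cases (ordinal_mem H A)) as [B | [B | B]]; auto.
  destruct (M x A B).
Qed.

Lemma omega_ind w (P : V -> Prop) : is_omega w -> definable1 P -> P (empty hV) ->
  (forall x, x ∈ w -> P x -> P (succ hV x)) -> forall x, x ∈ w -> P x.
Proof.
  intros Hw D P0 PS x Hx.
  assert (Ow : ordinal w) by apply Hw.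
  cut (x ∈ w -> P x); auto.
  apply (@ordinal_ind (fun x => x ∈ w -> P x)); [def | | apply (ordinal_mem Ow Hx)].
  intros a Ha IH A; destruct (omega_cases Hw A) as [-> | (y & B & ->)]; auto.
  assert (y ∈ w) by (apply (ordinal_trans Ow A B)); auto.
Qed.

Lemma omega_exists : exists w : V, is_omega w.
Proof.
  destruct (zfc_infinity hV) as (a & (e & E & F) & G).
  (* The finite ordinals, described without omega. The inductive set [a] may contain more, but by
     induction it contains all of these, so they form a set. *)
  set (nat x := ordinal x /\ ~ limit_ordinal x /\ forall y, y ∈ x -> ~ limit_ordinal y).
  assert (N : forall x y, nat x -> y ∈ x -> nat y).
  { intros x y (A & B & C) D; split; [apply (ordinal_mem A D) | split; [apply C, D |]].
    intros z I; apply C, (ordinal_trans A D I). }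
  assert (S : forall x, nat x -> nat (succ hV x)).
  { intros x (B & C & D); split; [apply ordinal_succ; auto | split].
    - intros (_ & _ & K); destruct (K x) as (z & L & M); [apply mem_succ; auto |].
      apply (is_succ_iff hV) in L; subst; apply (mem_irrefl M).
    - intros y K; apply mem_succ in K; destruct K as [K | ->]; auto. }
  assert (T : forall x, ordinal x -> nat x -> x ∈ a).
  { apply (@ordinal_ind (fun x => nat x -> x ∈ a)); [unfold nat; def |].
    intros x Ox IH Nx; destruct (ordinal_cases Ox) as [-> | [(y & A & ->) | A]].
    - apply is_empty_iff in E; subst; auto.
    - destruct (G y) as (z & I & J); [apply IH; auto; apply (N _ _ Nx A) |].
      apply (is_succ_iff hV) in I; subst; auto.
    - destruct Nx; tauto. }
  set (w := sep hV a nat).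
  assert (mw : forall x, x ∈ w <-> nat x).
  { intros x; unfold w; rewrite mem_sep by (unfold nat; def).
    split; [tauto |]; intros A; split; auto; apply T; auto; apply A. }
  exists w; split; [split; [split | split] |].
  - intros x A y B; apply mw; apply mw in A; apply (N _ _ A B).
  - intros x A; apply mw in A; apply (proj1 (proj1 A)).
  - exists (empty hV); apply mw; split; [apply ordinal_empty | split].
    + intros (_ & (x & A) & _); apply mem_empty in A; auto.
    + intros x A; apply mem_empty in A; tauto.
  - intros x A; exists (succ hV x); rewrite (is_succ_iff hV), mw; split; auto; apply S, mw, A.
  - intros x A; apply mw in A; apply (proj1 (proj2 A)).
Qed.
End Ordinals.

(** * The cumulative hierarchy, collection and choice *)

Section Hierarchy.
Variables (V : structure) (hV : ZFC V).
Implicit Types a b c d f g h p s t v w x y z X Y : V.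
Local Notation opair := (opair hV).
Local Notation app := (app hV).

Lemma set_exists b (P : V -> Prop) : definable1 P -> (forall z, P z -> z ∈ b) ->
  exists s, forall z, z ∈ s <-> P z.
Proof.
  intros D H; exists (sep hV b P); intros z; rewrite mem_sep by auto; split; [tauto | auto].
Qed.

Lemma opair_snd_mem g x y : opair x y ∈ g -> y ∈ bigcup hV (bigcup hV g).
Proof.
  intros H; apply mem_bigcup; exists (upair hV x y); split; [| apply mem_upair; auto].
  apply mem_bigcup; exists (opair x y); split; auto; apply mem_opair; auto.
Qed.

(** Stage [n] of a recursion on omega consists of [x] and the elements of elements of earlier
    stages. The union is transitive because an element of a member of stage [m] enters at stage
    [succ m]. *)
Lemma transitive_superset x : exists t, transitive_set t /\ subset x t.
Proof.
  destruct (omega_exists hV) as [n Hn].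
  destruct (@wf_recursion V hV n (fun x y => x ∈ y)
    (fun _ g z => z ∈ x \/ exists m v u, opair m v ∈ g /\ u ∈ v /\ z ∈ u)) as (h & _ & H1 & H2).
  - def.
  - def.
  - apply (wf_mem hV).
  - intros _ g; apply (@set_exists (cup hV x (bigcup hV (bigcup hV (bigcup hV (bigcup hV g)))))); [def |].
    intros z [A | (m & v & u & A & B & C)]; apply mem_cup; auto; right.
    apply mem_bigcup; exists u; split; auto; apply mem_bigcup; exists v; split; auto.
    apply (opair_snd_mem A).
  - destruct (@set_exists (bigcup hV (bigcup hV (bigcup hV h)))
      (fun z => exists m v, opair m v ∈ h /\ z ∈ v)) as [t Ht].
    + def.
    + intros z (m & v & A & B); apply mem_bigcup; exists v; split; auto; apply (opair_snd_mem A).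
    + exists t; split.
      * intros z A y B; apply Ht in A; apply Ht; destruct A as (m & v & A & C).
        assert (M := A); apply H1 in M; destruct M as [M _].
        exists (succ hV m), (app h (succ hV m)); split; [apply H1; split; auto; apply (omega_succ hV Hn M) |].
        apply H2; [apply (omega_succ hV Hn M) |]; right; exists m, v, z; split; auto.
        apply opair_restrict; [def |]; split; auto; apply mem_succ; auto.
      * intros z A; apply Ht; exists (empty hV), (app h (empty hV)).
        assert (M := omega_empty hV Hn); split; [apply H1; auto |]; apply H2; auto.
Qed.

Lemma mem_ind (P : V -> Prop) : definable1 P ->
  (forall x, (forall y, y ∈ x -> P y) -> P x) -> forall x, P x.
Proof.
  intros D H x; destruct (transitive_superset (sing hV x)) as (t & A & B).
  apply (wf_ind (X := t) (R := fun x y => x ∈ y) hV (@wf_mem V hV t) D).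
  - intros y C K; apply H; intros z E; apply K; auto; apply (A y C z E).
  - apply B, mem_sing; auto.
Qed.

(** Replacement needs one value per [y], so the least ordinal related to [y] is used; the bound is
    the successor of the supremum of these. *)
Lemma ordinal_bound x (Q : V -> V -> Prop) : definable2 Q ->
  exists b, ordinal b /\ forall y, y ∈ x -> (exists a, ordinal a /\ Q y a) ->
    exists a, a ∈ b /\ Q y a.
Proof.
  intros D.
  destruct (zfc_replacement hV (R := fun y a => ordinal a /\ Q y a /\ forall c, c ∈ a -> ~ Q y c))
    with (a := x) as [s Hs]; [def | |].
  - intros y a a' _ (A & B & C) (A' & B' & C').
    destruct (ordinal_linear hV A A') as [E | [E | E]]; auto; exfalso; [apply (C' a) | apply (C a')]; auto.
  - exists (succ hV (bigcup hV s)).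
    assert (O : forall a, a ∈ s -> ordinal a) by (intros a A; apply Hs in A; destruct A; tauto).
    split; [apply ordinal_succ, ordinal_bigcup; auto |].
    intros y Hy (a & A & B).
    destruct (@ordinal_least V hV (Q y) a) as (c & C & E & F); auto; [def |].
    assert (cs : c ∈ s) by (apply Hs; eauto).
    exists c; split; auto; apply mem_succ; destruct (ord_le_bigcup hV O cs); auto.
Qed.

(** The cumulative hierarchy: V_b is the union of the power sets of V_c for c < b, one clause for
    zero, successors and limits. [level a v] then says v = V_a. *)
Definition hierarchy h a : Prop :=
  forall b, b ∈ a -> forall z, z ∈ app h b <-> exists c, c ∈ b /\ subset z (app h c).

Definition level a v : Prop := ordinal a /\ exists h, hierarchy h (succ hV a) /\ v = app h a.
Local Hint Unfold hierarchy level : fo.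

Lemma hierarchy_unique h h' a : ordinal a -> hierarchy h (succ hV a) -> hierarchy h' (succ hV a) ->
  app h a = app h' a.
Proof.
  intros A B C.
  cut (a ∈ succ hV a -> app h a = app h' a); [intros K; apply K, mem_succ; auto |].
  assert (O := ordinal_succ hV A).
  generalize A; revert B C O; generalize (succ hV a) as d; intros d B C O.
  clear A; revert a.
  apply (@ordinal_ind V hV (fun a => a ∈ d -> app h a = app h' a)); [def |].
  intros a A IH K; apply (ext hV); intros z; rewrite (B a K), (C a K).
  split; intros (c & E & F); exists c; split; auto.
  - rewrite <- (IH c E); auto; apply (ordinal_trans O K E).
  - rewrite (IH c E); auto; apply (ordinal_trans O K E).
Qed.

Lemma level_unique a v v' : level a v -> level a v' -> v = v'.
Proof. intros (A & h & B & ->) (_ & h' & C & ->); apply hierarchy_unique; auto. Qed.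

Lemma hierarchy_sub h a c : ordinal a -> c ∈ a -> hierarchy h (succ hV a) -> hierarchy h (succ hV c).
Proof.
  intros O A B b C; apply B, mem_succ; left.
  apply mem_succ in C; destruct C as [C | ->]; auto; apply (ordinal_trans O A C).
Qed.

Lemma mem_level a v z : level a v -> (z ∈ v <-> exists c w, c ∈ a /\ level c w /\ subset z w).
Proof.
  intros (A & h & B & ->); rewrite (B a) by (apply mem_succ; auto); split.
  - intros (c & C & D); exists c, (app h c); repeat split; auto.
    + apply (proj1 (ordinal_mem A C)).
    + apply (proj2 (ordinal_mem A C)).
    + exists h; split; auto; apply (hierarchy_sub A C B).
  - intros (c & w & C & D & E); exists c; split; auto.
    replace (app h c) with w; auto; apply (@level_unique c); auto; split; [apply D |].
    exists h; split; auto; apply (hierarchy_sub A C B).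
Qed.

Lemma level_exists a : ordinal a -> exists v, level a v.
Proof.
  intros O.
  destruct (@wf_recursion V hV (succ hV a) (fun x y => x ∈ y)
    (fun _ g z => exists c w, opair c w ∈ g /\ subset z w)) as (h & _ & H1 & H2).
  - def.
  - def.
  - apply (wf_mem hV).
  - intros _ g; apply (@set_exists (power hV (bigcup hV (bigcup hV (bigcup hV g))))); [def |].
    intros z (c & w & A & B); apply mem_power; intros u C; apply mem_bigcup; exists w; split; auto.
    apply (opair_snd_mem A).
  - exists (app h a); split; auto; exists h; split; auto; intros b B z; rewrite (H2 b B); split.
    + intros (c & w & C & D); apply opair_restrict in C; [| def].
      destruct C as [C E]; apply H1 in C; destruct C as [_ ->]; eauto.
    + intros (c & C & D); exists c, (app h c); split; auto.
      apply opair_restrict; [def |]; split; auto; apply H1; split; auto.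
      apply (ordinal_trans (ordinal_succ hV O) B C).
Qed.

Lemma level_mono a b v w : level a v -> level b w -> a ∈ b -> subset v w.
Proof.
  intros A B C z D; apply (mem_level _ A) in D; apply (mem_level _ B).
  destruct D as (c & u & D & E & F); exists c, u; split; auto; apply (ordinal_trans (proj1 B) C D).
Qed.

(** By induction each element of [x] has a level; a common bound [b] makes [x] a subset of V_b,
    hence an element of the next level. *)
Lemma level_total x : exists a v, level a v /\ x ∈ v.
Proof.
  revert x; apply mem_ind; [def |]; intros x IH.
  destruct (@ordinal_bound x (fun y a => exists v, level a v /\ y ∈ v)) as (b & B & H); [def |].
  destruct (level_exists B) as [v Hv].
  destruct (level_exists (ordinal_succ hV B)) as [w Hw].
  exists (succ hV b), w; split; auto; apply (mem_level _ Hw).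
  exists b, v; rewrite mem_succ; split; [auto | split; [exact Hv |]].
  intros y C; destruct (H y C) as (a & D & u & E & F).
  - destruct (IH y C) as (a & u & D & E); exists a; split; eauto; apply D.
  - apply (level_mono E Hv D F).
Qed.

(** The witnesses of one [x] may form a proper class; bounding the least levels at which witnesses
    appear leaves a set that still contains one for each [x]. *)
Theorem collection a (R : V -> V -> Prop) : definable2 R ->
  exists b, forall x, x ∈ a -> (exists y, R x y) -> exists y, y ∈ b /\ R x y.
Proof.
  intros D.
  destruct (@ordinal_bound a (fun x c => exists v y, level c v /\ y ∈ v /\ R x y)) as (b & B & H); [def |].
  destruct (level_exists B) as [v Hv]; exists v; intros x Hx (y & A).
  destruct (level_total y) as (c & w & C & E).
  destruct (H x Hx) as (c' & F & w' & y' & I & J & K).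
  - exists c; split; [apply C | eauto].
  - exists y'; split; auto; apply (level_mono I Hv F J).
Qed.

Theorem choice_function a (R : V -> V -> Prop) : definable2 R ->
  (forall x, x ∈ a -> exists y, R x y) ->
  exists f b, is_function f a b /\ forall x, x ∈ a -> R x (app f x).
Proof.
  intros D H; destruct (collection a D) as [b Hb].
  destruct (choice_function_bounded hV (a := a) (b := b) D) as (f & A & B).
  - intros x Hx; destruct (Hb x Hx (H x Hx)) as (y & C & E); eauto.
  - eauto.
Qed.
End Hierarchy.

(** * Cardinals *)

Section Cardinals.
Variables (V : structure) (hV : ZFC V).
Implicit Types a b c d f g h p q s t v w x y z X Y : V.
Local Notation opair := (opair hV).
Local Notation app := (app hV).
Local Notation succ := (succ hV).
Local Notation product := (product hV).
Local Notation cup := (cup hV).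
Local Notation sing := (sing hV).

Definition injective_on a f : Prop := forall x y, x ∈ a -> y ∈ a -> app f x = app f y -> x = y.
Definition injects a b : Prop := exists f, is_function f a b /\ injective_on a f.
Local Hint Unfold injective_on injects : fo.

(** Choice selects the partners, so [R] need not be functional; it only has to keep the partners of
    different elements apart. *)
Lemma injects_rel a b (R : V -> V -> Prop) : definable2 R ->
  (forall x, x ∈ a -> exists y, y ∈ b /\ R x y) ->
  (forall x x' y, x ∈ a -> x' ∈ a -> y ∈ b -> R x y -> R x' y -> x = x') -> injects a b.
Proof.
  intros D H K; destruct (choice_function_bounded hV D H) as (f & A & B).
  exists f; split; auto; intros x y Hx Hy E; apply (K x y (app f x)); auto.
  - apply (function_app hV A Hx).
  - rewrite E; auto.
Qed.

Lemma injects_map a b (F : V -> V) : definable2 (fun x y => y = F x) ->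
  (forall x, x ∈ a -> F x ∈ b) ->
  (forall x y, x ∈ a -> y ∈ a -> F x = F y -> x = y) -> injects a b.
Proof.
  intros D H K; apply (injects_rel D); eauto; intros x x' y A B _ C E; apply K; congruence.
Qed.

Lemma injects_subset a b : subset a b -> injects a b.
Proof. intros H; apply (@injects_map a b (fun x => x)); auto; def. Qed.

Lemma injects_trans a b c : injects a b -> injects b c -> injects a c.
Proof.
  intros (f & A & B) (g & C & D); apply (@injects_map a c (fun x => app g (app f x))).
  - def.
  - intros x H; apply (function_app hV C), (function_app hV A H).
  - intros x y H K E; apply B; auto; apply D; auto; apply (function_app hV A); auto.
Qed.

Lemma injects_prod a b : injects a b -> injects (product a a) (product b b).
Proof.
  intros (f & A & B).
  apply (@injects_rel _ _ (fun p q => exists x y, p = opair x y /\ q = opair (app f x) (app f y))).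
  - def.
  - intros p H; apply mem_prod in H; destruct H as (x & y & H & K & ->).
    exists (opair (app f x) (app f y)); split; eauto.
    apply opair_prod; split; apply (function_app hV A); auto.
  - intros p p' q H K _ (x & y & -> & ->) (x' & y' & -> & E).
    apply opair_prod in H; apply opair_prod in K; apply opair_inj in E; destruct E as [E F].
    rewrite (B x x'), (B y y'); tauto.
Qed.

Lemma bijection_iff f a b : is_bijection f a b <->
  is_function f a b /\ injective_on a f /\ forall y, y ∈ b -> exists x, x ∈ a /\ app f x = y.
Proof.
  split; intros [H K]; split; auto.
  - split.
    + intros x y A B E; destruct (function_app hV H A) as [C _].
      destruct (K _ C) as (z & _ & D).
      transitivity z; [symmetry |]; apply D; apply (function_maps hV H); auto.
    + intros y A; destruct (K y A) as (x & B & _); exists x.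
      apply (maps_iff hV), (function_mem hV H) in B; destruct B; auto.
  - destruct K as [K L]; intros y A; destruct (L y A) as (x & B & <-); exists x; split.
    + apply (function_maps hV H); auto.
    + intros x' C; apply (maps_iff hV), (function_mem hV H) in C; destruct C; auto.
Qed.

Lemma equinumerous_sym a b : equinumerous a b -> equinumerous b a.
Proof.
  intros (f & H); apply bijection_iff in H; destruct H as (A & B & C).
  destruct (@choice_function_bounded V hV b a (fun y x => app f x = y)) as (g & D & E); auto; [def |].
  exists g; apply bijection_iff; split; auto; split.
  - intros x y H K L; rewrite <- (E x), <- (E y); auto; congruence.
  - intros x H; exists (app f x); split; [apply (function_app hV A H) |].
    assert (K := proj1 (function_app hV A H)); apply B; auto; apply (function_app hV D K).
Qed.

Lemma equinumerous_injects a b : equinumerous a b -> injects a b.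
Proof. intros (f & H); apply bijection_iff in H; exists f; tauto. Qed.

(** The transitive collapse of a well-order: [h] sends [x] to the set of values at its predecessors.
    Of two distinct points one precedes the other, so its value is an element of the other value,
    which gives injectivity. *)
Lemma order_type X (R : V -> V -> Prop) : definable2 R -> wf_on X R ->
  (forall x y z, x ∈ X -> y ∈ X -> z ∈ X -> R x y -> R y z -> R x z) ->
  (forall x y, x ∈ X -> y ∈ X -> x <> y -> R x y \/ R y x) ->
  exists t h, ordinal t /\ is_bijection h X t /\
    forall x, x ∈ X -> forall z, z ∈ app h x <-> exists y, y ∈ X /\ R y x /\ z = app h y.
Proof.
  intros D W T L.
  destruct (@wf_recursion V hV X R (fun x g z => exists y, opair y z ∈ g)) as (h & H0 & H1 & H2); auto.
  - def.
  - intros _ g; apply (@set_exists V hV (bigcup hV (bigcup hV g))); [def |].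
    intros z (y & A); apply (opair_snd_mem A).
  - assert (H : forall x, x ∈ X -> forall z, z ∈ app h x <-> exists y, y ∈ X /\ R y x /\ z = app h y).
    { intros x A z; rewrite (H2 x A); split; intros (y & B).
      - apply opair_restrict in B; auto; destruct B as [B C]; apply H1 in B; exists y; tauto.
      - destruct B as (B & C & ->); exists y; apply opair_restrict; auto; split; auto; apply H1; auto. }
    destruct (@set_exists V hV (bigcup hV (bigcup hV h)) (fun z => exists x, opair x z ∈ h)) as [t Ht].
    { def. } { intros z (x & A); apply (opair_snd_mem A). }
    assert (O : forall x, x ∈ X -> ordinal (app h x)).
    { apply (wf_ind hV (R := R) (P := fun x => ordinal (app h x)) W); [def |].
      intros x A IH; apply transitive_ordinal.
      - intros y B z C; apply (H x A) in B; destruct B as (y' & B & E & ->).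
        apply (H y' B) in C; destruct C as (z' & C & F & ->).
        apply (H x A); exists z'; eauto.
      - intros y B; apply (H x A) in B; destruct B as (y' & B & E & ->); auto. }
    assert (Hi : injective_on X h).
    { intros x y A B E; apply NNPP; intros N; destruct (L x y A B N) as [C | C];
        apply (mem_irrefl hV (x := app h x)).
      - rewrite E at 2; apply H; eauto.
      - rewrite E at 1; apply H; eauto. }
    exists t, h; split; [| split; auto].
    + apply transitive_ordinal.
      * intros z A y B; apply Ht in A; destruct A as (x & A); apply H1 in A; destruct A as [A ->].
        apply (H x A) in B; destruct B as (y' & B & _ & ->); apply Ht; exists y'; apply H1; auto.
      * intros z A; apply Ht in A; destruct A as (x & A); apply H1 in A; destruct A as [A ->]; auto.
    + assert (F : is_function h X t).
      { split.
        - intros p A; destruct (H0 p A) as (x & v & ->).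
          assert (B := A); apply H1 in B; destruct B as [B ->].
          exists x, (app h x); rewrite (is_opair_iff hV); repeat split; auto; apply Ht; eauto.
        - intros x A; exists (app h x); split; [apply (maps_iff hV), H1; auto |].
          intros v B; apply (maps_iff hV), H1 in B; symmetry; tauto. }
      apply bijection_iff; split; auto; split; auto.
      intros z A; apply Ht in A; destruct A as (x & A); apply H1 in A; destruct A as [A ->]; eauto.
Qed.

(** Let [m] be the least ordinal into which [a] injects. The image of [a] in [m] has an order type
    [t] at most [m], since collapsing never raises an ordinal, and minimality forces t = m. So [a]
    is in bijection with [m], which is a cardinal by minimality again. *)
Lemma cardinal_of_injects a d : ordinal d -> injects a d ->
  exists c, has_cardinality a c /\ ord_le c d.
Proof.
  intros Hd H.
  destruct (@ordinal_least V hV (injects a) d) as (m & Om & (f & A & B) & L); auto.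
  { def. }
  destruct (@set_exists V hV m (fun y => exists x, x ∈ a /\ y = app f x)) as [b Hb].
  { def. } { intros y (x & C & ->); apply (function_app hV A C). }
  assert (Sb : subset b m) by (intros y C; apply Hb in C; destruct C as (x & C & ->); apply (function_app hV A C)).
  assert (Ob : forall x, x ∈ b -> ordinal x) by (intros x C; apply (ordinal_mem Om), Sb, C).
  destruct (@order_type b (fun x y => x ∈ y)) as (t & h & Ot & Bh & Hh).
  { def. } { apply (wf_mem hV). }
  { intros x y z C D E F G; apply (ordinal_trans (Ob z E) G F). }
  { intros x y C D E; destruct (ordinal_linear hV (Ob x C) (Ob y D)) as [F | [F | F]]; tauto. }
  apply bijection_iff in Bh; destruct Bh as (F & G & I).
  assert (P : forall x, x ∈ b -> ord_le (app h x) x).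
  { apply (wf_ind hV (R := fun x y => x ∈ y) (P := fun x => ord_le (app h x) x) (@wf_mem V hV b)); [def |].
    intros x C IH; apply ordinal_subset_le; auto.
    - apply (ordinal_mem Ot), (function_app hV F C).
    - intros z D; apply (Hh x C) in D; destruct D as (y & D & E & ->).
      apply (ord_le_mem (Ob x C) (IH y D E) E). }
  assert (T : ord_le t m).
  { apply ordinal_subset_le; auto; intros z C; destruct (I z C) as (x & D & <-).
    apply (ord_le_mem Om (P x D) (Sb x D)). }
  assert (Q : forall x, x ∈ a -> app f x ∈ b) by (intros x C; apply Hb; eauto).
  assert (Df : definable2 (fun x y => y = app h (app f x))) by def.
  assert (E : is_bijection (lam hV a (fun x => app h (app f x))) a t).
  { apply bijection_iff; split; [| split].
    - apply lam_function; auto; intros x C; apply (function_app hV F); auto.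
    - intros x y C D; rewrite !app_lam; auto.
    - intros z C; destruct (I z C) as (y & D & <-); apply Hb in D; destruct D as (x & D & ->).
      exists x; rewrite app_lam; auto. }
  assert (tm : t = m).
  { destruct T as [T | T]; auto; destruct (L t T); apply equinumerous_injects; eexists; eauto. }
  subst m; exists t; split; [split; [split; auto |] |].
  - intros c C K; apply (L c C).
    apply (@injects_trans a t c); apply equinumerous_injects; [eexists; eauto |].
    apply equinumerous_sym; auto.
  - eexists; eauto.
  - apply (ordinal_not_mem hV Ot Hd); intros N; apply (L d N H).
Qed.

Lemma card_lt_injects a c : card_lt a c -> exists d, d ∈ c /\ injects a d.
Proof. intros (d & [_ A] & B); exists d; split; auto; apply equinumerous_injects; auto. Qed.

Lemma injects_card_lt a d c : ordinal c -> d ∈ c -> injects a d -> card_lt a c.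
Proof.
  intros Oc A B; destruct (@cardinal_of_injects a d) as (m & C & D); auto.
  - apply (ordinal_mem Oc A).
  - exists m; split; auto; apply (ord_le_mem Oc D A).
Qed.

Lemma card_lt_mono a b c : ordinal c -> injects a b -> card_lt b c -> card_lt a c.
Proof.
  intros Oc A B; apply card_lt_injects in B; destruct B as (d & B & C).
  apply (injects_card_lt Oc B (injects_trans A C)).
Qed.

Lemma cardinal_not_injects c d : cardinal c -> d ∈ c -> ~ injects c d.
Proof.
  intros [Oc C] A B; destruct (cardinal_of_injects (ordinal_mem Oc A) B) as (m & [_ D] & E).
  apply (C m); [apply (ord_le_mem Oc E A) | apply equinumerous_sym; auto].
Qed.

Lemma card_lt_not_subset c a : cardinal c -> card_lt a c -> ~ subset c a.
Proof.
  intros H K S; apply card_lt_injects in K; destruct K as (d & A & B).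
  apply (cardinal_not_injects H A), (injects_trans (injects_subset S) B).
Qed.

(** Dedekind finiteness when [w] is omega; it allows finite sets to be treated by injections
    alone. *)
Definition small w a : Prop := ~ injects w a.
Local Hint Unfold small : fo.

Lemma small_injects w a b : injects a b -> small w b -> small w a.
Proof. intros H K L; apply K, (injects_trans L H). Qed.

Lemma succ_inj x y : succ x = succ y -> x = y.
Proof.
  intros E; assert (A : x ∈ succ y) by (rewrite <- E; apply mem_succ; auto).
  assert (B : y ∈ succ x) by (rewrite E; apply mem_succ; auto).
  apply mem_succ in A; apply mem_succ in B; destruct A as [A | A], B as [B | B]; auto.
  destruct (mem_asym hV A B).
Qed.

(* If the value [x] is taken at [m], skip the index [m]. *)
Lemma small_add w a x : is_omega w -> small w a -> small w (cup a (sing x)).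
Proof.
  intros Hw S (f & A & B); apply S.
  assert (Ow : ordinal w) by apply Hw.
  assert (Sw := omega_succ hV Hw).
  assert (val : forall n, n ∈ w -> app f n <> x -> app f n ∈ a).
  { intros n C D; destruct (function_app hV A C) as [E _]; apply mem_cup in E.
    destruct E as [E | E]; auto; apply mem_sing in E; tauto. }
  destruct (classic (exists n, n ∈ w /\ app f n = x)) as [(m & C & D) | N].
  - apply (@injects_rel w a (fun n y => (n ∈ m /\ y = app f n) \/ (~ n ∈ m /\ y = app f (succ n)))).
    + def.
    + intros n E; destruct (classic (n ∈ m)) as [F | F].
      * exists (app f n); split; auto; apply val; auto; rewrite <- D; intros G.
        apply B in G; auto; subst; apply (mem_irrefl hV F).
      * assert (G := omega_succ hV Hw E).
        exists (app f (succ n)); split; auto; apply val; auto; rewrite <- D; intros I.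
        apply B in I; auto; subst; apply F, mem_succ; auto.
    + intros n n' y E F _ [[G ->] | [G ->]] [[I J] | [I J]];
        apply B in J; auto.
      * subst; destruct I; apply (ordinal_trans (ordinal_mem Ow C) G), mem_succ; auto.
      * subst; destruct G; apply (ordinal_trans (ordinal_mem Ow C) I), mem_succ; auto.
      * apply succ_inj; auto.
  - exists f; split; auto; apply (function_mono (hV := hV) A); intros n E; apply val; auto; eauto.
Qed.

Lemma small_add_prod w a x : is_omega w -> small w a ->
  forall k, k ∈ w -> small w (cup a (product (sing x) k)).
Proof.
  intros Hw S; apply (omega_ind (hV := hV) Hw); [def | |].
  - revert S; apply small_injects, injects_subset; intros p A; apply mem_cup in A.
    destruct A as [A | A]; auto; apply mem_prod in A; destruct A as (_ & y & _ & A & _).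
    apply mem_empty in A; tauto.
  - intros k Hk IH; apply (small_add (x := opair x k) Hw) in IH; revert IH.
    apply small_injects, injects_subset; intros p A; apply mem_cup; rewrite mem_cup, mem_sing.
    apply mem_cup in A; destruct A as [A | A]; auto.
    apply mem_prod in A; destruct A as (x' & y & B & A & ->).
    apply mem_sing in B; apply mem_succ in A; subst; destruct A as [A | ->]; auto.
    left; right; apply opair_prod; rewrite mem_sing; auto.
Qed.

(** Rows are added one at a time. The lemma rules out the finite squares in [square_injects]. *)
Lemma small_prod w n : is_omega w -> n ∈ w -> forall k, k ∈ w -> small w (product k n).
Proof.
  intros Hw Hn; apply (omega_ind (hV := hV) Hw); [def | |].
  - intros (f & A & _); assert (B := omega_empty hV Hw); apply (function_app hV A) in B.
    destruct B as [B _]; apply mem_prod in B; destruct B as (y & _ & B & _).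
    apply mem_empty in B; tauto.
  - intros k Hk IH; apply (small_add_prod (x := k) Hw) with (k := n) in IH; auto; revert IH.
    apply small_injects, injects_subset; intros p A; apply mem_cup.
    apply mem_prod in A; destruct A as (x & y & A & B & ->).
    rewrite !opair_prod, mem_sing; apply mem_succ in A; tauto.
Qed.

(** Hilbert's hotel: [a] moves to zero, the elements of omega move up by one, everything else
    stays. *)
Lemma infinite_succ w a : is_omega w -> ordinal a -> ord_le w a -> injects (succ a) a.
Proof.
  intros Hw Ha L; assert (S := ordinal_le_subset Ha L).
  apply (@injects_rel _ _ (fun x y => (x = a /\ y = empty hV) \/
    (x <> a /\ x ∈ w /\ y = succ x) \/ (x <> a /\ ~ x ∈ w /\ y = x))).
  - def.
  - intros x A; apply mem_succ in A; destruct (classic (x = a)) as [-> | N].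
    + exists (empty hV); split; auto; apply S, (omega_empty hV Hw).
    + destruct A as [A | A]; [| tauto]; destruct (classic (x ∈ w)) as [B | B].
      * exists (succ x); split; auto; apply S, (omega_succ hV Hw B).
      * exists x; split; auto; right; right; auto.
  - assert (E : forall x, empty hV <> succ x).
    { intros x E; apply (mem_empty hV x); rewrite E; apply mem_succ; auto. }
    intros x x' y A B _ [[-> ->] | [(C & D & ->) | (C & D & ->)]]
      [[-> F] | [(F & G & I) | (F & G & I)]]; auto; subst.
    + destruct (E _ I).
    + destruct G; apply (omega_empty hV Hw).
    + destruct (E x); auto.
    + apply succ_inj; auto.
    + destruct G; apply (omega_succ hV Hw D).
    + destruct D; apply (omega_empty hV Hw).
    + destruct D; apply (omega_succ hV Hw G).
Qed.

Lemma infinite_cardinal_succ w c x : is_omega w -> cardinal c -> ord_le w c -> x ∈ c -> succ x ∈ c.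
Proof.
  intros Hw [Oc C] L A; assert (Ox := ordinal_mem Oc A).
  destruct (ordinal_linear hV (ordinal_succ hV Ox) Oc) as [B | [B | B]]; auto.
  - subst c; destruct (classic (ord_le w x)) as [D | D].
    + destruct (cardinal_not_injects (c := succ x) (d := x)); auto; [split; auto |].
      apply (infinite_succ Hw Ox D).
    + destruct L as [L | L]; [destruct D; apply mem_succ in L; destruct L as [L | L];
        [left | right]; auto |].
      subst w; apply (omega_succ hV Hw A).
  - apply mem_succ in B; destruct B as [B | ->]; [destruct (mem_asym hV A B) | destruct (mem_irrefl hV A)].
Qed.
End Cardinals.

#[global] Hint Unfold injective_on injects small : fo.

(** * Squares of infinite ordinals *)

Section Square.
Variables (V : structure) (hV : ZFC V).
Implicit Types a b c d f g h p q s t u v w x y z X Y : V.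
Local Notation opair := (opair hV).
Local Notation app := (app hV).
Local Notation succ := (succ hV).
Local Notation product := (product hV).
Local Notation cup := (cup hV).
Local Notation sing := (sing hV).
Local Notation injects := (injects hV).

Lemma ordinal_cup a b : ordinal a -> ordinal b -> ordinal (cup a b).
Proof.
  intros A B; apply (ordinal_bigcup hV); intros x C; apply mem_upair in C; destruct C; subst; auto.
Qed.

Lemma cup_cases a b : ordinal a -> ordinal b -> cup a b = a \/ cup a b = b.
Proof.
  intros A B; destruct (ordinal_linear hV A B) as [C | [<- | C]].
  - right; apply (ext hV); intros x; rewrite mem_cup; split; auto; intros [D | D]; auto.
    apply (ordinal_trans B C D).
  - left; apply (ext hV); intros x; rewrite mem_cup; tauto.
  - left; apply (ext hV); intros x; rewrite mem_cup; split; auto; intros [D | D]; auto.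
    apply (ordinal_trans A C D).
Qed.

Lemma cup_mem a b c : ordinal c -> a ∈ c -> b ∈ c -> cup a b ∈ c.
Proof.
  intros H A B; destruct (cup_cases (ordinal_mem H A) (ordinal_mem H B)) as [-> | ->]; auto.
Qed.

Lemma ord_le_cup_l a b : ordinal a -> ordinal b -> ord_le a (cup a b).
Proof.
  intros A B; apply ordinal_subset_le; auto using ordinal_cup; intros x C; apply mem_cup; auto.
Qed.

Lemma ord_le_cup_r a b : ordinal a -> ordinal b -> ord_le b (cup a b).
Proof.
  intros A B; apply ordinal_subset_le; auto using ordinal_cup; intros x C; apply mem_cup; auto.
Qed.

(* Goedel's order: by maximum, then lexicographically; [cup] is the maximum of two ordinals. *)
Definition goedel_lt a b c d : Prop :=
  cup a b ∈ cup c d \/ (cup a b = cup c d /\ (a ∈ c \/ (a = c /\ b ∈ d))).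

Definition goedel p q : Prop :=
  exists a b c d, p = opair a b /\ q = opair c d /\ goedel_lt a b c d.

Lemma goedel_opair a b c d : goedel (opair a b) (opair c d) <-> goedel_lt a b c d.
Proof.
  split.
  - intros (a' & b' & c' & d' & A & B & C); apply opair_inj in A; apply opair_inj in B.
    destruct A, B; subst; auto.
  - intros A; exists a, b, c, d; auto.
Qed.

Lemma goedel_definable : definable2 goedel.
Proof. unfold goedel, goedel_lt; def. Qed.

(** Three successive minimisations follow the three keys of the order: maximum, first coordinate,
    second coordinate. *)
Lemma goedel_wf o : ordinal o -> wf_on (product o o) goedel.
Proof.
  intros O Y S (p & Hp).
  assert (SY : forall a b, opair a b ∈ Y -> ordinal a /\ ordinal b).
  { intros a b A; apply S, opair_prod in A; split; apply (ordinal_mem O); tauto. }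
  assert (H := S _ Hp); apply mem_prod in H; destruct H as (a0 & b0 & A0 & B0 & ->).
  destruct (@ordinal_least V hV (fun m => exists a b, opair a b ∈ Y /\ m = cup a b) (cup a0 b0))
    as (m & Om & (a1 & b1 & H1 & ->) & Lm); eauto.
  { def. } { apply ordinal_cup; apply (SY _ _ Hp). }
  destruct (@ordinal_least V hV (fun a => exists b, opair a b ∈ Y /\ cup a b = cup a1 b1) a1)
    as (a & Oa & (b2 & H2 & E2) & La); eauto.
  { def. } { apply (SY _ _ H1). }
  destruct (@ordinal_least V hV (fun b => opair a b ∈ Y /\ cup a b = cup a1 b1) b2)
    as (b & Ob & (H3 & E3) & Lb); eauto.
  { def. } { apply (SY _ _ H2). }
  exists (opair a b); split; auto; intros q Hq G.
  assert (K := S _ Hq); apply mem_prod in K; destruct K as (c & d & C & D & ->).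
  apply goedel_opair in G; destruct G as [G | (E & [G | (-> & G)])].
  - apply (Lm (cup c d)); [rewrite <- E3 |]; eauto.
  - apply (La c G); exists d; split; auto; congruence.
  - apply (Lb d G); split; auto; congruence.
Qed.

(** Induction on [o]. A non-cardinal is in bijection with a smaller infinite ordinal. For a
    cardinal, Goedel's order has type at most [o]: otherwise the pairs before the one at position
    [o] would inject [o] into a square that is finite or, by induction, injects into a smaller
    ordinal. *)
Lemma square_injects w o : is_omega w -> ordinal o -> ord_le w o -> injects (product o o) o.
Proof.
  intros Hw O; revert o O.
  apply (@ordinal_ind V hV (fun o => ord_le w o -> injects (product o o) o)).
  { def. }
  intros o O IH L.
  assert (Ow : ordinal w) by apply Hw.
  assert (small_sq : forall n, n ∈ w -> ~ injects w (product n n)).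
  { intros n Hn; apply (small_prod Hw Hn Hn). }
  destruct (classic (cardinal o)) as [C | C].
  - destruct (@order_type V hV (product o o) goedel) as (t & h & Ot & Bh & Hh).
    + apply goedel_definable.
    + apply goedel_wf; auto.
    + intros p q r A B C'; apply mem_prod in A; apply mem_prod in B; apply mem_prod in C'.
      destruct A as (a1 & b1 & A1 & B1 & ->), B as (a2 & b2 & A2 & B2 & ->),
        C' as (a3 & b3 & A3 & B3 & ->); rewrite !goedel_opair.
      assert (O3 : ordinal (cup a3 b3)) by (apply ordinal_cup; apply (ordinal_mem O); auto).
      intros [E | (E & F)] [G | (G & I)].
      * left; apply (ordinal_trans O3 G E).
      * left; rewrite <- G; auto.
      * left; rewrite E; auto.
      * right; split; [congruence |]; destruct F as [F | [-> F]], I as [I | [-> I]]; auto.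
        -- left; apply (ordinal_trans (ordinal_mem O A3) I F).
        -- right; split; auto; apply (ordinal_trans (ordinal_mem O B3) I F).
    + intros p q A B N; apply mem_prod in A; apply mem_prod in B.
      destruct A as (a1 & b1 & A1 & B1 & ->), B as (a2 & b2 & A2 & B2 & ->); rewrite !goedel_opair.
      assert (O1 := ordinal_mem O A1); assert (O2 := ordinal_mem O A2).
      assert (P1 := ordinal_mem O B1); assert (P2 := ordinal_mem O B2).
      unfold goedel_lt.
      destruct (ordinal_linear hV (ordinal_cup O1 P1) (ordinal_cup O2 P2)) as [E | [E | E]]; auto.
      destruct (ordinal_linear hV O1 O2) as [F | [F | F]]; auto 6.
      destruct (ordinal_linear hV P1 P2) as [G | [G | G]]; subst; auto 7; tauto.
    + destruct (proj1 (bijection_iff hV h (product o o) t) Bh) as (F & I & J).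
      destruct (classic (o ∈ t)) as [T | T].
      2:{ assert (E : equinumerous (product o o) t) by (exists h; auto).
          apply (injects_trans (equinumerous_injects hV E)), injects_subset.
          apply (ordinal_le_subset O), (ordinal_not_mem hV Ot O T). }
      destruct (J o T) as (p & Hp & E); apply mem_prod in Hp; destruct Hp as (a & b & A & B & ->).
      (* Pairs preceding [opair a b] have maximum at most [m], so both coordinates lie in
         [succ m]. *)
      set (m := cup a b).
      assert (Hm : m ∈ o) by (apply cup_mem; auto).
      assert (Om := ordinal_mem O Hm).
      assert (K : injects o (product (succ m) (succ m))).
      { apply (@injects_rel V hV o (product (succ m) (succ m)) (fun z q => z = app h q)).
        - def.
        - intros z Hz; rewrite <- E in Hz; apply Hh in Hz; [| apply opair_prod; auto].
          destruct Hz as (q & Hq & G & ->); exists q; split; auto.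
          apply mem_prod in Hq; destruct Hq as (c & d & C1 & D1 & ->); apply goedel_opair in G.
          assert (M : ord_le (cup c d) m) by (unfold m, ord_le; destruct G as [G | (G & _)]; auto).
          assert (Oc := ordinal_mem O C1); assert (Od := ordinal_mem O D1).
          apply opair_prod; rewrite !mem_succ; split.
          + apply (ord_le_trans Om (ord_le_cup_l Oc Od) M).
          + apply (ord_le_trans Om (ord_le_cup_r Oc Od) M).
        - intros; congruence. }
      exfalso; destruct (classic (ord_le w m)) as [N | N].
      * apply (cardinal_not_injects (hV := hV) C Hm).
        apply (injects_trans K), (injects_trans (injects_prod (infinite_succ hV Hw Om N))); auto.
      * apply (small_sq (succ m)).
        -- apply (omega_succ hV Hw), NNPP; intros Q; apply N, (ordinal_not_mem hV Ow Om Q).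
        -- apply (injects_trans (injects_subset hV (ordinal_le_subset O L)) K).
  - assert (D : exists b, b ∈ o /\ equinumerous b o).
    { apply NNPP; intros N; apply C; split; auto; intros b A B; apply N; eauto. }
    destruct D as (b & A & B).
    assert (Ob := ordinal_mem O A).
    assert (E := equinumerous_injects hV B).
    assert (F := equinumerous_injects hV (equinumerous_sym hV B)).
    assert (G : ord_le w b).
    { apply (ordinal_not_mem hV Ow Ob); intros N; apply (small_sq b N).
      apply (injects_trans (injects_subset hV (ordinal_le_subset O L))), (injects_trans F).
      apply (@injects_map V hV b (product b b) (fun x => opair x x)).
      - def.
      - intros x H; apply opair_prod; auto.
      - intros x y _ _ H; apply opair_inj in H; tauto. }
    apply (injects_trans (injects_prod F)), (injects_trans (IH b A G) E).
Qed.

(** * Cofinality *)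

(** A singular cardinal is not a successor cardinal. If no cardinal lay between [a] and [c], all
    ordinals below [c] would inject into one [m] < [c]; choosing such injections along the cofinal
    map would inject [c] into the square of [m]. *)
Lemma limit_of_cardinals w c d f : is_omega w -> cardinal c -> w ∈ c -> cofinal_map f d c -> d ∈ c ->
  forall a, a ∈ c -> exists b, b ∈ c /\ a ∈ b /\ cardinal b.
Proof.
  intros Hw C L [F K] D a A; apply NNPP; intros N.
  assert (Oc : ordinal c) by apply C.
  (* Above [a], so that no cardinal lies strictly between [m] and [c]; above omega, so that the
     square of [m] injects into [m]; above [d], so that indices of the cofinal map are elements of
     [m]. *)
  set (m := cup (cup a w) d).
  assert (Hm : m ∈ c) by (repeat apply cup_mem; auto).
  assert (Om := ordinal_mem Oc Hm).
  assert (Oa := ordinal_mem Oc A); assert (Ow := ordinal_mem Oc L); assert (Od := ordinal_mem Oc D).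
  assert (Oaw := ordinal_cup Oa Ow).
  assert (am : ord_le a m) by (apply (ord_le_trans Om (ord_le_cup_l Oa Ow)), (ord_le_cup_l Oaw Od)).
  assert (wm : ord_le w m) by (apply (ord_le_trans Om (ord_le_cup_r Oa Ow)), (ord_le_cup_l Oaw Od)).
  assert (dm : subset d m) by (apply (ordinal_le_subset Om), (ord_le_cup_r Oaw Od)).
  assert (H : forall b, b ∈ c -> injects b m).
  { intros b B; assert (Ob := ordinal_mem Oc B).
    destruct (cardinal_of_injects Ob (injects_subset hV (fun x (H : x ∈ b) => H)))
      as (e & [Ce E] & I).
    apply (injects_trans (equinumerous_injects hV E)), injects_subset.
    apply (ordinal_le_subset Om), (ordinal_not_mem hV (proj1 Ce) Om).
    intros J; apply N; exists e; split; [apply (ord_le_mem Oc I B) |].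
    split; [apply (ord_le_mem (proj1 Ce) am J) | exact Ce]. }
  destruct (@choice_function V hV d (fun x g => is_function g (succ (app f x)) m /\
    injective_on hV (succ (app f x)) g)) as (e & B & He & Ee).
  { def. }
  { intros x Hx; destruct (H (succ (app f x))) as (g & G); eauto.
    apply (infinite_cardinal_succ hV Hw C); [left; auto |]; apply (function_app hV F Hx). }
  assert (J : injects c (product m m)).
  { apply (@injects_rel V hV c (product m m)
      (fun y p => exists x, x ∈ d /\ y ∈ succ (app f x) /\ p = opair x (app (app e x) y))).
    - def.
    - intros y Hy; destruct (K y Hy) as (x & z & Hx & M & I).
      apply (function_maps hV F) in M; auto; subst z.
      assert (I' : y ∈ succ (app f x)) by (apply mem_succ; auto).
      exists (opair x (app (app e x) y)); split; [| eauto].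
      apply opair_prod; split; auto; apply (function_app hV (proj1 (Ee x Hx)) I').
    - intros y y' p _ _ _ (x & Hx & I & ->) (x' & _ & I' & G).
      apply opair_inj in G; destruct G as [<- G]; apply (proj2 (Ee x Hx)); auto. }
  apply (cardinal_not_injects (hV := hV) C Hm), (injects_trans J), (square_injects Hw Om wm).
Qed.

(* The supremum of [f] on [x]: turns a cofinal map into a monotone one. *)
Definition below f x := bigcup hV (repl hV x (app f)).

Lemma mem_below f x z : z ∈ below f x <-> exists y, y ∈ x /\ z ∈ app f y.
Proof.
  unfold below; rewrite mem_bigcup; split.
  - intros (u & A & B); apply mem_repl in A; [| def]; destruct A as (y & A & ->); eauto.
  - intros (y & A & B); exists (app f y); split; auto; apply mem_repl; [def | eauto].
Qed.
Local Hint Resolve mem_below : fomem.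

Section Cofinality.
Variables (w k d : V).
Hypotheses (Hw : is_omega w) (Ck : cardinal k) (wk : w ∈ k) (Hcof : has_cofinality k d).

Lemma cofinality_ordinal : ordinal d.
Proof. apply Hcof. Qed.

Lemma cofinality_bounded b g : b ∈ d -> is_function g b k ->
  exists y, y ∈ k /\ forall x, x ∈ b -> app g x ∈ y.
Proof.
  intros B G; destruct Hcof as (_ & _ & H); apply NNPP; intros N; apply (H b B); exists g; split; auto.
  intros y Hy; apply NNPP; intros K; apply N; exists y; split; auto; intros x Hx.
  assert (Og : ordinal (app g x)) by (apply (ordinal_mem (proj1 Ck)), (function_app hV G Hx)).
  apply NNPP; intros M; apply K; exists x, (app g x); rewrite (function_maps hV G _ Hx).
  split; [auto | split; auto]; apply (ordinal_not_mem hV (ordinal_mem (proj1 Ck) Hy) Og M).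
Qed.

Lemma succ_mem_k x : x ∈ k -> succ x ∈ k.
Proof. apply (infinite_cardinal_succ hV Hw Ck); left; auto. Qed.

Lemma cofinal_succ f : cofinal_map f d k -> forall y, y ∈ k -> exists x, x ∈ d /\ y ∈ app f x.
Proof.
  intros [F K] y Hy; destruct (K (succ y) (succ_mem_k Hy)) as (x & z & Hx & M & I).
  apply (function_maps hV F) in M; auto; subst z; exists x; split; auto.
  apply (mem_ord_le (ordinal_mem (proj1 Ck) (proj1 (function_app hV F Hx))) (b := succ y)); auto.
  apply mem_succ; auto.
Qed.

(** If [d] were the successor of [x], the values of a cofinal map on [x] would be bounded by some
    [y], and no value would exceed the maximum of [y] and the last one. *)
Lemma cofinality_succ x : x ∈ d -> succ x ∈ d.
Proof.
  intros Hx; assert (Od := cofinality_ordinal); assert (Ox := ordinal_mem Od Hx).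
  destruct (ordinal_linear hV (ordinal_succ hV Ox) Od) as [A | [A | A]]; auto; exfalso.
  - destruct Hcof as (_ & (f & F) & _); assert (Hf := proj1 F).
    destruct (@cofinality_bounded x (lam hV x (app f))) as (y & Hy & B); auto.
    { apply lam_function; [def |]; intros z Hz; apply (function_app hV Hf), (ordinal_trans Od Hx Hz). }
    destruct (cofinal_succ F (y := cup y (app f x))) as (z & Hz & K).
    { apply cup_mem; [apply Ck | auto | apply (function_app hV Hf Hx)]. }
    rewrite <- A in Hz; apply mem_succ in Hz.
    destruct Hz as [Hz | ->].
    + specialize (B z Hz); rewrite app_lam in B by (auto; def).
      assert (Oz : z ∈ d) by (apply (ordinal_trans Od Hx Hz)).
      apply (mem_asym hV K), mem_cup; auto.
    + apply (mem_irrefl hV (x := cup y (app f x))), mem_cup; auto.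
  - apply mem_succ in A; destruct A as [A | ->]; [apply (mem_asym hV A Hx) | apply (mem_irrefl hV Hx)].
Qed.

Lemma below_mem f x : cofinal_map f d k -> x ∈ d -> below f x ∈ k.
Proof.
  intros [F _] Hx; assert (Od := cofinality_ordinal).
  assert (V1 : forall z, z ∈ x -> app f z ∈ k).
  { intros z Hz; apply (function_app hV F), (ordinal_trans Od Hx Hz). }
  destruct (@cofinality_bounded x (lam hV x (app f))) as (y & Hy & B); auto.
  { apply lam_function; [def | auto]. }
  apply (ord_le_mem (proj1 Ck) (b := y)); auto; apply ordinal_subset_le; auto.
  - apply (ordinal_bigcup hV); intros u A; apply mem_repl in A; [| def].
    destruct A as (z & A & ->); apply (ordinal_mem (proj1 Ck)); auto.
  - apply (ordinal_mem (proj1 Ck) Hy).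
  - intros u A; apply mem_below in A; destruct A as (z & A & D).
    specialize (B z A); rewrite app_lam in B by (auto; def).
    apply (ordinal_trans (ordinal_mem (proj1 Ck) Hy) B D).
Qed.

Lemma below_mono f x y : x ∈ d -> y ∈ d -> ord_le x y -> subset (below f x) (below f y).
Proof.
  intros Hx Hy L z A; apply mem_below in A; apply mem_below; destruct A as (u & A & B).
  exists u; split; auto; apply (ordinal_le_subset (ordinal_mem cofinality_ordinal Hy) L A).
Qed.

Lemma below_cofinal f y : cofinal_map f d k -> y ∈ k -> exists x, x ∈ d /\ y ∈ below f x.
Proof.
  intros F Hy; destruct (cofinal_succ F Hy) as (x & A & B).
  (* [below f x] ignores the value at [x] itself, hence the shift by one. *)
  exists (succ x); split; [apply (cofinality_succ A) |].
  apply mem_below; exists x; rewrite mem_succ; auto.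
Qed.

(** Following [g] by the monotone cofinal map [below f] gives a map from [b] to [k], which is
    bounded as [b] < [d]. A point [y] where [below f] exceeds this bound lies above all values of
    [g]. *)
Lemma cofinality_regular b g : b ∈ d -> is_function g b d ->
  exists y, y ∈ d /\ forall x, x ∈ b -> app g x ∈ y.
Proof.
  intros B G; assert (Od := cofinality_ordinal).
  destruct Hcof as (_ & (f & F) & _).
  assert (Dg : definable2 (fun x y => y = below f (app g x))) by def.
  destruct (@cofinality_bounded b (lam hV b (fun x => below f (app g x)))) as (c & Hc & H); auto.
  { apply lam_function; auto; intros x Hx; apply below_mem; auto; apply (function_app hV G Hx). }
  destruct (below_cofinal F Hc) as (y & Hy & K); exists y; split; auto; intros x Hx.
  assert (Hg : app g x ∈ d) by apply (function_app hV G Hx).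
  apply NNPP; intros N; apply (ordinal_not_mem hV (ordinal_mem Od Hy) (ordinal_mem Od Hg)) in N.
  specialize (H x Hx); rewrite app_lam in H by auto.
  apply (mem_asym hV H), (below_mono Hy Hg N K).
Qed.

Lemma cofinality_cardinal : cardinal d.
Proof.
  split; [apply cofinality_ordinal |]; intros b B (g & G); apply (bijection_iff hV) in G.
  destruct G as (F & _ & S); destruct (cofinality_regular B F) as (y & Hy & H).
  destruct (S y Hy) as (x & Hx & E); specialize (H x Hx); rewrite E in H; apply (mem_irrefl hV H).
Qed.

(** A smaller cardinality would enumerate [a] by a function from an element of [d], which regularity
    bounds. This is the source of uniformity of the derived ultrafilter. *)
Lemma unbounded_cardinality a : subset a d -> (forall y, y ∈ d -> ~ subset a y) -> has_cardinality a d.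
Proof.
  intros S N; destruct (cardinal_of_injects cofinality_ordinal (injects_subset hV S))
    as (m & [Cm E] & L).
  destruct L as [L | ->]; [exfalso | split; auto].
  apply (equinumerous_sym hV) in E; destruct E as (g & G); apply (bijection_iff hV) in G.
  destruct G as (F & _ & T).
  destruct (@cofinality_regular m g L) as (y & Hy & H).
  - apply (function_mono (hV := hV) F); intros x Hx; apply S, (function_app hV F Hx).
  - apply (N y Hy); intros x Hx; destruct (T x Hx) as (z & Hz & <-); auto.
Qed.

Lemma cofinality_le : ord_le d k.
Proof.
  apply (ordinal_not_mem hV cofinality_ordinal (proj1 Ck)); intros A.
  destruct Hcof as (_ & _ & H); apply (H k A).
  exists (lam hV k (fun x => x)); split.
  - apply lam_function; auto; def.
  - intros y Hy; exists y, y; split; auto; split; [| right; auto].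
    apply (maps_iff hV), opair_lam; auto; def.
Qed.
End Cofinality.

(** Stated for an arbitrary set [s] and in primitive notions, so that it can be transferred to [M]
    and applied there to [D] and [j k]. *)
Lemma regular_bounded w k s : is_omega w -> cardinal k -> w ∈ k -> has_cofinality k k -> card_lt s k ->
  exists y, y ∈ k /\ forall x, x ∈ s -> x ∈ k -> x ∈ y.
Proof.
  intros Hw Ck wk H L; apply NNPP; intros N.
  set (a := sep hV k (fun x => x ∈ s)).
  assert (ma : forall x, x ∈ a <-> x ∈ k /\ x ∈ s) by (intros x; unfold a; rewrite mem_sep by def; tauto).
  assert (A : has_cardinality a k).
  { apply (@unbounded_cardinality w k k); auto.
    - intros x B; apply ma in B; tauto.
    - intros y Hy S; apply N; exists y; split; auto; intros x B C; apply S, ma; auto. }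
  destruct A as [_ A]; apply (card_lt_injects hV) in L; destruct L as (e & He & L).
  apply (cardinal_not_injects (hV := hV) Ck He); revert L; apply injects_trans.
  apply (injects_trans (equinumerous_injects hV (equinumerous_sym hV A))), injects_subset.
  intros x B; apply ma in B; tauto.
Qed.
End Square.

#[global] Hint Resolve mem_below : fomem.

(** * Elementary embeddings *)

(** A single formula must express [Phi] in every structure; only then does elementarity carry [Phi]
    from [V] to [submodel M]. *)
Definition expressible (Phi : structure -> Prop) : Prop :=
  exists p, forall (S : structure) (e : nat -> S), Phi S <-> sat e p.
Definition expressible1 (Phi : forall S : structure, S -> Prop) : Prop :=
  exists p, forall (S : structure) (e : nat -> S), Phi S (e 0) <-> sat e p.
Definition expressible2 (Phi : forall S : structure, S -> S -> Prop) : Prop :=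
  exists p, forall (S : structure) (e : nat -> S), Phi S (e 0) (e 1) <-> sat e p.
Definition expressible3 (Phi : forall S : structure, S -> S -> S -> Prop) : Prop :=
  exists p, forall (S : structure) (e : nat -> S), Phi S (e 0) (e 1) (e 2) <-> sat e p.

Ltac expr := eexists; intros; cbv beta; fo.

Tactic Notation "transport" hyp(H) constr(t) := generalize (t H); clear H; intros H; cbv beta in H.

Section Transfer.
Variables (V : structure) (hV : ZFC V) (M : V -> Prop) (j : V -> submodel M).
Hypothesis Hj : elementary j.

Lemma transfer (Phi : structure -> Prop) : expressible Phi -> Phi V -> Phi (submodel M).
Proof.
  intros (p & H) K; set (e := fun _ : nat => inhabitant hV).
  apply (H (submodel M) (fun n => j (e n))), Hj, H; auto.
Qed.

Lemma transfer1 (Phi : forall S : structure, S -> Prop) : expressible1 Phi ->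
  forall x, Phi V x <-> Phi (submodel M) (j x).
Proof.
  intros (p & H) x; set (e := fun _ : nat => x).
  etransitivity; [apply (H V e) |]; etransitivity; [apply (Hj p e) |].
  symmetry; apply (H (submodel M) (fun n => j (e n))).
Qed.

Lemma transfer2 (Phi : forall S : structure, S -> S -> Prop) : expressible2 Phi ->
  forall x y, Phi V x y <-> Phi (submodel M) (j x) (j y).
Proof.
  intros (p & H) x y; set (e := scons x (fun _ => y)).
  etransitivity; [apply (H V e) |]; etransitivity; [apply (Hj p e) |].
  symmetry; apply (H (submodel M) (fun n => j (e n))).
Qed.

Lemma transfer3 (Phi : forall S : structure, S -> S -> S -> Prop) : expressible3 Phi ->
  forall x y z, Phi V x y z <-> Phi (submodel M) (j x) (j y) (j z).
Proof.
  intros (p & H) x y z; set (e := scons x (scons y (fun _ => z))).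
  etransitivity; [apply (H V e) |]; etransitivity; [apply (Hj p e) |].
  symmetry; apply (H (submodel M) (fun n => j (e n))).
Qed.

Lemma transfer_mem x y : x ∈ y -> j x ∈ j y.
Proof. apply (@transfer2 (fun S x y => x ∈ y)); expr. Qed.

Lemma transfer_cardinal c : cardinal c -> cardinal (j c).
Proof. apply (@transfer1 (fun S c => cardinal c)); expr. Qed.

Lemma transfer_subset a b : subset a b -> subset (j a) (j b).
Proof. apply (@transfer2 (fun S a b => subset a b)); expr. Qed.

Lemma transfer_maps f x y : maps f x y -> maps (j f) (j x) (j y).
Proof. apply (@transfer3 (fun S f x y => maps f x y)); expr. Qed.

Lemma submodel_ext (HM : transitive_class M) (x y : submodel M) : (forall z, z ∈ x <-> z ∈ y) -> x = y.
Proof.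
  destruct x as [x Hx], y as [y Hy]; simpl; intros H.
  assert (E : x = y).
  { apply (ext hV); intros z; split; intros A.
    - apply (H (exist _ z (HM _ _ Hx A))), A.
    - apply (H (exist _ z (HM _ _ Hy A))), A. }
  subst y; f_equal; apply proof_irrelevance.
Qed.

(** Transferring the universally quantified sentence makes it available for sets of [M] outside the
    range of [j]. *)
Lemma card_lt_not_subset_sub (a c : submodel M) : cardinal c -> card_lt a c -> ~ subset c a.
Proof.
  revert a c; apply (@transfer (fun S => forall a c : S, cardinal c -> card_lt a c -> ~ subset c a)).
  - expr.
  - intros a c; apply (card_lt_not_subset hV).
Qed.
End Transfer.

(** * Ultrapowers *)

Definition pick (a b c n : nat) : nat := match n with 0 => a | 1 => b | _ => c end.

(** Says that variable [x] has the value denoted by [n]: for [n < k] this is an already bound value,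
    otherwise the value of a function at the index. The two quantifiers added at an atom shift
    everything by 2; the index variable in between accounts for [n + 3]. *)
Definition value_is (g : formula) (x k n : nat) : formula :=
  if n <? k then FEq x (n + 2) else rename (pick (n + 3) (k + 2) x) g.

(* [lift g k p] expresses [p] with the variables [n >= k] read as the values at
   variable [k] of the functions [n + 1]; [g] is a formula for [maps]. *)
Fixpoint lift (g : formula) (k : nat) (p : formula) : formula :=
  match p with
  | FMem m n => FEx (FEx (FAnd (value_is g 1 k m) (FAnd (value_is g 0 k n) (FMem 1 0))))
  | FEq m n => FEx (FEx (FAnd (value_is g 1 k m) (FAnd (value_is g 0 k n) (FEq 1 0))))
  | FFalse => FFalse
  | FAnd p q => FAnd (lift g k p) (lift g k q)
  | FOr p q => FOr (lift g k p) (lift g k q)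
  | FImp p q => FImp (lift g k p) (lift g k q)
  | FAll p => FAll (lift g (S k) p)
  | FEx p => FEx (lift g (S k) p)
  end.

Lemma sat_lift (V : structure) (g : formula)
  (Hg : forall e : nat -> V, maps (e 0) (e 1) (e 2) <-> sat e g) (p : formula) :
  forall k (e e' : nat -> V), (forall n, n < k -> e n = e' n) ->
  (forall n, k <= n -> forall z, maps (e (S n)) (e k) z <-> z = e' n) ->
  (sat e (lift g k p) <-> sat e' p).
Proof.
  assert (val : forall k (e e' : nat -> V), (forall n, n < k -> e n = e' n) ->
    (forall n, k <= n -> forall z, maps (e (S n)) (e k) z <-> z = e' n) ->
    forall n u v, (sat (scons v (scons u e)) (value_is g 1 k n) <-> u = e' n) /\
                  (sat (scons v (scons u e)) (value_is g 0 k n) <-> v = e' n)).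
  { intros k e e' H K n u v; unfold value_is; destruct (Nat.ltb_spec n k) as [L | L].
    - simpl; replace (n + 2) with (S (S n)) by lia; simpl; rewrite (H n L); tauto.
    - set (E := scons v (scons u e)).
      assert (Q : forall x, sat E (rename (pick (n + 3) (k + 2) x) g) <-> E x = e' n).
      { intros x; rewrite <- (K n L).
        replace (e (S n)) with (E (n + 3)) by (replace (n + 3) with (S (S (S n))) by lia; auto).
        replace (e k) with (E (k + 2)) by (replace (k + 2) with (S (S k)) by lia; auto).
        rewrite <- (sat_rename (r := pick (n + 3) (k + 2) x) (e := E)
          (e' := fun m => E (pick (n + 3) (k + 2) x m)) g) by auto.
        symmetry; apply (Hg (fun m => E (pick (n + 3) (k + 2) x m))). }
      split; apply Q. }
  induction p; simpl; intros k e e' H K.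
  - split.
    + intros (u & v & A & B & C); apply (val _ _ _ H K) in A; apply (val _ _ _ H K) in B.
      subst; auto.
    + intros A; exists (e' m), (e' n); repeat split; auto; apply (val _ _ _ H K); auto.
  - split.
    + intros (u & v & A & B & C); apply (val _ _ _ H K) in A; apply (val _ _ _ H K) in B.
      subst; auto.
    + intros A; exists (e' m), (e' n); repeat split; auto; apply (val _ _ _ H K); auto.
  - tauto.
  - rewrite (IHp1 _ _ _ H K), (IHp2 _ _ _ H K); tauto.
  - rewrite (IHp1 _ _ _ H K), (IHp2 _ _ _ H K); tauto.
  - rewrite (IHp1 _ _ _ H K), (IHp2 _ _ _ H K); tauto.
  - assert (Q : forall x, sat (scons x e) (lift g (S k) p) <-> sat (scons x e') p).
    { intros x; apply IHp.
      - intros [|n] L; simpl; auto; apply H; lia.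
      - intros [|n] L; [lia |]; simpl; apply K; lia. }
    split; intros A x; apply Q; auto.
  - assert (Q : forall x, sat (scons x e) (lift g (S k) p) <-> sat (scons x e') p).
    { intros x; apply IHp.
      - intros [|n] L; simpl; auto; apply H; lia.
      - intros [|n] L; [lia |]; simpl; apply K; lia. }
    split; intros [x A]; exists x; apply Q; auto.
Qed.

Section Ultrapower.
Variables (V : structure) (hV : ZFC V) (l I U : V).
Hypotheses (Hl : uncountable_cardinal l) (HU : ultrafilter_over I U) (HC : complete_over l I U).
Implicit Types a b c d f g h p q s t u v w x y z T X Y : V.
Local Notation opair := (opair hV).
Local Notation app := (app hV).

(** Phrased through a set in [U], it makes sense for every predicate; definability is asked only
    where a measure-one set must be formed from the predicate. *)
Definition ae (P : V -> Prop) : Prop := exists a, a ∈ U /\ forall i, i ∈ a -> P i.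

Lemma measure_sub a i : a ∈ U -> i ∈ a -> i ∈ I.
Proof. intros A; apply (proj1 HU a A). Qed.

Lemma ae_mono (P Q : V -> Prop) : (forall i, i ∈ I -> P i -> Q i) -> ae P -> ae Q.
Proof. intros H (a & A & B); exists a; split; auto; intros i C; apply H; auto; apply (measure_sub A C). Qed.

Lemma ae_all (P : V -> Prop) : (forall i, i ∈ I -> P i) -> ae P.
Proof. intros H; exists I; split; auto; apply HU. Qed.

Lemma ae_and (P Q : V -> Prop) : ae P -> ae Q -> ae (fun i => P i /\ Q i).
Proof.
  intros (a & A & B) (b & C & D).
  exists (sep hV a (fun i => i ∈ b)).
  assert (m : forall i, i ∈ sep hV a (fun i => i ∈ b) <-> i ∈ a /\ i ∈ b)
    by (intros i; rewrite mem_sep; [tauto | def]).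
  split.
  - destruct HU as (_ & _ & _ & _ & H & _); apply (H a b); auto.
  - intros i E; apply m in E; split; [apply B | apply D]; tauto.
Qed.

Lemma ae_ex (P : V -> Prop) : ae P -> exists i, i ∈ I /\ P i.
Proof.
  intros (a & A & B); apply NNPP; intros N; destruct HU as (_ & _ & H & _).
  apply (H a); auto; intros i C; apply N; exists i; split; auto; apply (measure_sub A C).
Qed.

Lemma ae_sep (P : V -> Prop) : definable1 P -> ae P -> sep hV I P ∈ U.
Proof.
  intros D (a & A & B); destruct HU as (_ & _ & _ & H & _); apply (H a); auto.
  - intros i C; apply mem_sep; auto; split; auto; apply (measure_sub A C).
  - intros i C; apply mem_sep in C; tauto.
Qed.

Lemma ae_not (P : V -> Prop) : definable1 P -> ~ ae P -> ae (fun i => ~ P i).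
Proof.
  intros D N; destruct HU as (_ & _ & _ & _ & _ & H).
  destruct (H (sep hV I P) (sep hV I (fun i => ~ P i))) as [A | A].
  - intros i C; apply mem_sep in C; tauto.
  - intros i; rewrite !mem_sep; auto; [tauto | def].
  - destruct N; exists (sep hV I P); split; auto; intros i C; apply mem_sep in C; tauto.
  - exists (sep hV I (fun i => ~ P i)); split; auto; intros i C.
    apply mem_sep in C; [tauto | def].
Qed.

Lemma ae_contra (P Q : V -> Prop) : (forall i, i ∈ I -> P i -> Q i -> False) -> ae P -> ~ ae Q.
Proof.
  intros H A B; destruct (ae_ex (ae_and A B)) as (i & C & D & E); eauto.
Qed.

(** The truth sets of [Q x] for [x] in [b] form a set by replacement, and it injects into [b], so
    completeness applies to it. *)
Lemma ae_all_lt b (Q : V -> V -> Prop) : definable2 Q -> b ∈ l ->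
  (forall x, x ∈ b -> ae (fun i => Q x i)) -> ae (fun i => forall x, x ∈ b -> Q x i).
Proof.
  intros D Hb H.
  destruct (zfc_replacement hV (R := fun x a => forall i, i ∈ a <-> i ∈ I /\ Q x i))
    with (a := b) as [s Hs].
  { def. }
  { intros x y z _ A B; apply (ext hV); intros i; rewrite A, B; tauto. }
  assert (Ds : forall x, definable1 (Q x)) by (intros x; def).
  exists (sep hV I (fun i => forall a, a ∈ s -> i ∈ a)).
  assert (m : forall i, i ∈ sep hV I (fun i => forall a, a ∈ s -> i ∈ a) <-> i ∈ I /\ forall a, a ∈ s -> i ∈ a)
    by (intros i; rewrite mem_sep; [tauto | def]).
  split.
  - apply (HC (s := s)); auto.
    + intros a A; apply Hs in A; destruct A as (x & A & B).
      replace a with (sep hV I (Q x)); [apply ae_sep; auto |].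
      apply (ext hV); intros i; rewrite mem_sep, B; auto; tauto.
    + apply (injects_card_lt (hV := hV) (d := b)); auto; [apply Hl |].
      apply (@injects_rel V hV s b (fun a x => forall i, i ∈ a <-> i ∈ I /\ Q x i)).
      * def.
      * intros a A; apply Hs in A; auto.
      * intros a a' x _ _ _ A B; apply (ext hV); intros i; rewrite A, B; tauto.
  - intros i A x Hx; apply m in A; destruct A as [A B].
    assert (K : sep hV I (Q x) ∈ s).
    { apply Hs; exists x; split; auto; intros k; apply mem_sep; auto. }
    apply B in K; apply mem_sep in K; auto; tauto.
Qed.

(** * The transitive collapse of the ultrapower *)

Definition ult_mem f g : Prop := ae (fun i => app f i ∈ app g i).
Definition ult_eq f g : Prop := ae (fun i => app f i = app g i).
Local Hint Unfold ae ult_mem ult_eq : fo.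

Lemma ult_eq_sym f g : ult_eq f g -> ult_eq g f.
Proof. apply ae_mono; auto. Qed.

Lemma ult_mem_eq f g f' g' : ult_eq f f' -> ult_eq g g' -> ult_mem f g -> ult_mem f' g'.
Proof.
  intros A B C; generalize (ae_and (ae_and A B) C); apply ae_mono.
  intros i _ ((E & F) & G); rewrite <- E, <- F; auto.
Qed.

(* By completeness the stages of a descending sequence of functions would descend
   in [V] at a common index. *)
Lemma ult_wf T : wf_on (funset hV I T) ult_mem.
Proof.
  intros Y _ (f0 & H0); apply NNPP; intros N.
  destruct (@choice_function_bounded V hV Y Y (fun f g => ult_mem g f)) as (F & HF & EF).
  { def. }
  { intros f Hf; apply NNPP; intros K; apply N; exists f; split; auto; intros g Hg A; eauto. }
  destruct (omega_exists hV) as (w & Hw).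
  destruct (@wf_recursion V hV w (fun x y => x ∈ y)
    (fun n g z => (is_empty n /\ z ∈ f0) \/
       exists m v, is_succ n m /\ opair m v ∈ g /\ z ∈ app F v)) as (h & _ & H1 & H2).
  { def. } { def. } { apply (wf_mem hV). }
  { intros n g; apply (@set_exists V hV (cup hV f0 (bigcup hV (bigcup hV (bigcup hV F)))));
      [def |].
    intros z [[_ A] | (m & v & _ & _ & A)]; apply mem_cup; auto; right.
    apply mem_app in A; destruct A as (y & A & B); apply mem_bigcup; exists y; split; auto.
    apply (opair_snd_mem B). }
  assert (E0 : app h (empty hV) = f0).
  { apply (ext hV); intros z; rewrite (H2 _ (omega_empty hV Hw)); split.
    - intros [[_ A] | (m & v & A & _)]; auto; apply (is_succ_iff hV) in A.
      exfalso; apply (mem_empty hV m); rewrite A; apply mem_succ; auto.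
    - intros A; left; split; auto; apply (is_empty_iff hV); auto. }
  assert (ES : forall n, n ∈ w -> app h (succ hV n) = app F (app h n)).
  { intros n Hn; assert (HS := omega_succ hV Hw Hn); apply (ext hV); intros z; rewrite (H2 _ HS); split.
    - intros [[A _] | (m & v & A & B & C)].
      + destruct (A n); apply mem_succ; auto.
      + apply (is_succ_iff hV), succ_inj in A; subst m.
        apply opair_restrict in B; [| def]; destruct B as [B _].
        apply H1 in B; destruct B as [_ ->]; auto.
    - intros A; right; exists n, (app h n); rewrite (is_succ_iff hV); split; auto; split; auto.
      apply opair_restrict; [def |]; split; [apply H1; auto | apply mem_succ; auto]. }
  assert (HY : forall n, n ∈ w -> app h n ∈ Y).
  { apply (omega_ind (hV := hV) Hw); [def | rewrite E0; auto |].
    intros n Hn IH; rewrite ES; auto; apply (function_app hV HF IH). }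
  assert (A : ae (fun i => forall n, n ∈ w -> app (app h (succ hV n)) i ∈ app (app h n) i)).
  { apply (@ae_all_lt w (fun n i => app (app h (succ hV n)) i ∈ app (app h n) i)).
    - def.
    - destruct Hl as (Cl & w' & Hw' & L); replace w with w'; auto.
      destruct (ordinal_linear hV (proj1 (proj1 Hw)) (proj1 (proj1 Hw'))) as [A | [A | A]]; auto.
      + destruct (proj2 Hw' w A (proj1 Hw)).
      + destruct (proj2 Hw w' A (proj1 Hw')).
    - intros n Hn; rewrite ES; auto; apply EF; auto. }
  destruct (ae_ex A) as (i & _ & B).
  assert (Di : definable2 (fun n y => y = app (app h n) i)) by (def).
  destruct (@zfc_foundation V hV (repl hV w (fun n => app (app h n) i))) as (y & C & D).
  - exists (app (app h (empty hV)) i); apply mem_repl; auto; exists (empty hV); split; auto.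
    apply (omega_empty hV Hw).
  - apply mem_repl in C; auto; destruct C as (n & Hn & ->).
    apply (D (app (app h (succ hV n)) i)); auto.
    apply mem_repl; auto; exists (succ hV n); split; auto; apply (omega_succ hV Hw Hn).
Qed.

(** Recursion is available only on sets, while the functions on [I] need not form one; so the
    Mostowski collapse is taken on the functions into one set [T] at a time. *)
Definition collapses T h : Prop :=
  forall f, is_function f I T ->
    forall z, z ∈ app h f <-> exists g, is_function g I T /\ ult_mem g f /\ z = app h g.
Local Hint Unfold collapses : fo.

Lemma collapse_exists T : exists h, collapses T h.
Proof.
  destruct (@wf_recursion V hV (funset hV I T) ult_mem (fun x g z => exists y, opair y z ∈ g))
    as (h & _ & H1 & H2).
  - def.
  - def.
  - apply ult_wf.
  - intros _ g; apply (@set_exists V hV (bigcup hV (bigcup hV g))); [def |].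
    intros z (y & A); apply (opair_snd_mem A).
  - exists h; intros f Hf z; rewrite H2 by (apply mem_funset; auto); split.
    + intros (g & A); apply opair_restrict in A; [| def]; destruct A as [A B].
      apply H1 in A; rewrite mem_funset in A; exists g; tauto.
    + intros (g & A & B & ->); exists g; apply opair_restrict; [def |].
      split; auto; apply H1; rewrite mem_funset; auto.
Qed.

Lemma function_of T (R : V -> V -> Prop) : definable2 R ->
  (forall i, i ∈ I -> exists z, z ∈ T /\ R i z) ->
  exists f, is_function f I T /\ forall i, i ∈ I -> R i (app f i).
Proof. apply choice_function_bounded. Qed.

(* Hence admitting functions with values outside [T] does not change the collapse of a
   [T]-valued function. *)
Lemma ult_mem_bounded T f f' g : transitive_set T -> is_function f I T -> ult_eq f f' -> ult_mem g f' ->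
  exists g', is_function g' I T /\ ult_eq g' g /\ ult_mem g' f.
Proof.
  intros HT Hf E M.
  destruct (@function_of T (fun i z => (app g i ∈ app f i /\ z = app g i) \/
    (~ app g i ∈ app f i /\ z = app f i))) as (g' & A & B).
  - def.
  - intros i Hi; assert (K := proj1 (function_app hV Hf Hi)).
    destruct (classic (app g i ∈ app f i)) as [C | C]; eauto.
    exists (app g i); split; auto; apply (HT _ K _ C).
  - assert (Q : ult_eq g' g).
    { generalize (ae_and E M); apply ae_mono; intros i Hi [C D]; rewrite <- C in D.
      destruct (B i Hi) as [[F G] | [F G]]; tauto. }
    exists g'; split; [auto | split; [auto |]]; apply (@ult_mem_eq g f' g' f); auto using ult_eq_sym.
Qed.

Lemma function_ind T (P : V -> Prop) : definable1 P ->
  (forall f, is_function f I T -> (forall g, is_function g I T -> ult_mem g f -> P g) -> P f) ->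
  forall f, is_function f I T -> P f.
Proof.
  intros D H f Hf; apply (wf_ind hV (ult_wf (T := T)) D); [| apply mem_funset; auto].
  intros g Hg IH; apply mem_funset in Hg; apply H; auto.
  intros g' Hg'; apply IH, mem_funset; auto.
Qed.

(** By [ult_mem_bounded] each member of one function can be replaced, up to [ult_eq], by a member
    with values in the other bound, and induction matches the elements of the two collapses. *)
Lemma collapse_eq T T' h h' f f' : transitive_set T -> transitive_set T' ->
  collapses T h -> collapses T' h' -> is_function f I T -> is_function f' I T' ->
  ult_eq f f' -> app h f = app h' f'.
Proof.
  intros HT HT' Hh Hh' Hf; revert f'; revert f Hf.
  apply (@function_ind T (fun f => forall f', is_function f' I T' -> ult_eq f f' -> app h f = app h' f')).
  { def. }
  intros f Hf IH f' Hf' E; apply (ext hV); intros z; rewrite (Hh f Hf z), (Hh' f' Hf' z); split.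
  - intros (g & Hg & M & ->).
    destruct (ult_mem_bounded HT' Hf' (ult_eq_sym E) M) as (g' & Hg' & E' & M').
    exists g'; split; [auto | split; [auto |]]; apply IH; auto using ult_eq_sym.
  - intros (g' & Hg' & M & ->).
    destruct (ult_mem_bounded HT Hf E M) as (g & Hg & E' & M').
    exists g; split; [auto | split; [auto |]]; symmetry; apply IH; auto.
Qed.

(** Extensionality of the ultrapower. If [f] and [f'] differ almost everywhere, some [k] lies in one
    and not in the other; equality of the collapses provides a [k'] with the same collapse in the
    other, and induction identifies [k] with [k']. *)
Lemma collapse_inj T h f f' : transitive_set T -> collapses T h ->
  is_function f I T -> is_function f' I T -> app h f = app h f' -> ult_eq f f'.
Proof.
  intros HT Hh Hf; revert f'; revert f Hf.
  apply (@function_ind T (fun f => forall f', is_function f' I T -> app h f = app h f' -> ult_eq f f')).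
  { def. }
  assert (wit : forall f f', is_function f I T -> ae (fun i => exists z, z ∈ app f i /\ ~ z ∈ app f' i) ->
    exists k, is_function k I T /\ ult_mem k f /\ ~ ult_mem k f').
  { intros f f' Hf A.
    (* At indices without a difference the default [app f i] keeps the values of [k] in [T]. *)
    destruct (@function_of T (fun i z => (z ∈ app f i /\ ~ z ∈ app f' i) \/
      (~ (exists u, u ∈ app f i /\ ~ u ∈ app f' i) /\ z = app f i))) as (k & B & C).
    - def.
    - intros i Hi; assert (K := proj1 (function_app hV Hf Hi)).
      destruct (classic (exists u, u ∈ app f i /\ ~ u ∈ app f' i)) as [(u & D) | D]; eauto.
      exists u; split; auto; apply (HT _ K u); tauto.
    - assert (D : ae (fun i => app k i ∈ app f i /\ ~ app k i ∈ app f' i)).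
      { revert A; apply ae_mono; intros i Hi A; destruct (C i Hi); tauto. }
      exists k; split; auto; split; [revert D; apply ae_mono; tauto |].
      revert D; apply ae_contra; tauto. }
  intros f Hf IH f' Hf' E; apply NNPP; intros N.
  assert (A : ae (fun i => app f i <> app f' i)) by (apply ae_not; auto; def).
  destruct (classic (ae (fun i => exists z, z ∈ app f i /\ ~ z ∈ app f' i))) as [B | B].
  - destruct (wit f f' Hf B) as (k & Hk & K1 & K2); apply K2.
    assert (Z : app h k ∈ app h f') by (rewrite <- E; apply Hh; eauto).
    apply Hh in Z; auto; destruct Z as (k' & Hk' & K3 & K4).
    apply (ult_mem_eq (ult_eq_sym (IH k Hk K1 k' Hk' K4)) (g := f')); auto; apply ae_all; auto.
  - apply ae_not in B; [| def].
    assert (C : ae (fun i => exists z, z ∈ app f' i /\ ~ z ∈ app f i)).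
    { generalize (ae_and A B); apply ae_mono; intros i _ [C D]; apply NNPP; intros K.
      apply C, (ext hV); intros z; split; intros F; apply NNPP; intros G; [apply D | apply K]; eauto. }
    destruct (wit f' f Hf' C) as (k & Hk & K1 & K2); apply K2.
    assert (Z : app h k ∈ app h f) by (rewrite E; apply Hh; eauto).
    apply Hh in Z; auto; destruct Z as (k' & Hk' & K3 & K4).
    apply (ult_mem_eq (IH k' Hk' K3 k Hk (eq_sym K4)) (g := f)); auto; apply ae_all; auto.
Qed.

(* [z] is the value of the class of [f] in the transitive collapse of the ultrapower;
   it depends neither on the bound [T] for the values of [f] nor on [h]. *)
Definition represents f z : Prop :=
  exists T h, transitive_set T /\ is_function f I T /\ collapses T h /\ z = app h f.
Local Hint Unfold represents : fo.

Lemma represents_exists f T : is_function f I T -> exists z, represents f z.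
Proof.
  intros H; destruct (transitive_superset hV T) as (T' & A & B).
  destruct (collapse_exists T') as (h & C); exists (app h f), T', h; split; [auto |]; split; [| auto].
  apply (function_mono (hV := hV) H); intros i Hi; apply B, (function_app hV H Hi).
Qed.

Lemma represents_common f g z u : represents f z -> represents g u ->
  exists T h, transitive_set T /\ collapses T h /\ is_function f I T /\ is_function g I T /\
    z = app h f /\ u = app h g.
Proof.
  intros (T & h & A & B & C & ->) (T' & h' & A' & B' & C' & ->).
  destruct (transitive_superset hV (cup hV T T')) as (X & D & E).
  destruct (collapse_exists X) as (k & F).
  assert (Gf : is_function f I X).
  { apply (function_mono (hV := hV) B); intros i Hi; apply E, mem_cup; left; apply (function_app hV B Hi). }
  assert (Gg : is_function g I X).
  { apply (function_mono (hV := hV) B'); intros i Hi; apply E, mem_cup; right; apply (function_app hV B' Hi). }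
  exists X, k; split; [auto |]; split; [auto |]; split; [auto |]; split; [auto |].
  split; [apply (collapse_eq A D) | apply (collapse_eq A' D)]; auto; apply ae_all; auto.
Qed.

Lemma represents_eq f g z u : represents f z -> represents g u -> (z = u <-> ult_eq f g).
Proof.
  intros A B; destruct (represents_common A B) as (T & h & C & D & E & F & -> & ->); split.
  - apply (collapse_inj C D); auto.
  - apply (collapse_eq C C); auto.
Qed.

Lemma represents_mem f g z u : represents f z -> represents g u -> (z ∈ u <-> ult_mem f g).
Proof.
  intros A B; destruct (represents_common A B) as (T & h & C & D & E & F & -> & ->).
  rewrite (D g F); split.
  - intros (k & Hk & K & L); apply (collapse_inj C D) in L; auto.
    apply (@ult_mem_eq k g f g); auto using ult_eq_sym; apply ae_all; auto.
  - eauto.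
Qed.

Lemma represents_elem g u z : represents g u -> z ∈ u -> exists f, represents f z.
Proof.
  intros (T & h & A & B & C & ->) D; apply (C g B) in D; destruct D as (f & E & _ & ->).
  exists f, T, h; auto.
Qed.

(** * Łoś's theorem and the ultrapower embedding *)

Definition ultrapower z : Prop := exists f, represents f z.

Lemma ultrapower_transitive : transitive_class ultrapower.
Proof. intros x y [f A] B; apply (represents_elem A B). Qed.

Lemma represents_values f z : represents f z -> forall i, i ∈ I -> forall y, maps f i y <-> y = app f i.
Proof. intros (T & h & _ & A & _) i Hi y; apply (function_maps hV A); auto. Qed.

Lemma maps_expressible : expressible3 (fun S (f i y : S) => maps f i y).
Proof. expr. Qed.

(** [lift] turns the truth of [p] at the values of the functions into a formula about the index [i],
    with the functions as parameters. This is what lets separation and choice act on truth sets in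
    Łoś's theorem. *)
Lemma truth_definable (p : formula) (e : nat -> V) : (forall n, exists z, represents (e n) z) ->
  exists P, definable1 P /\ forall i, i ∈ I -> (P i <-> sat (fun n => app (e n) i) p).
Proof.
  intros H; destruct maps_expressible as (g & Hg).
  exists (fun i => sat (scons i e) (lift g 0 p)); split; [exists (lift g 0 p), e; tauto |].
  intros i Hi; apply (sat_lift (Hg V)); [intros n L; inversion L |].
  intros n _ z; simpl; destruct (H n) as [u Hu]; apply (represents_values Hu Hi).
Qed.

Lemma truth_definable2 (p : formula) (e : nat -> V) : (forall n, exists z, represents (e n) z) ->
  exists P, definable2 P /\
    forall i y, i ∈ I -> (P i y <-> sat (scons y (fun n => app (e n) i)) p).
Proof.
  intros H; destruct maps_expressible as (g & Hg).
  assert (D : definable2 (fun y i => sat (scons y (scons i e)) (lift g 1 p)))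
    by (exists (lift g 1 p), e; tauto).
  set (Q := fun y i => sat (scons y (scons i e)) (lift g 1 p)) in D.
  exists (fun i y => Q y i); split; [clearbody Q; def |].
  intros i y Hi; apply (sat_lift (Hg V)).
  - intros [|n] L; simpl; auto; lia.
  - intros [|n] L; [lia |]; simpl; destruct (H n) as [u Hu]; apply (represents_values Hu Hi).
Qed.

Lemma sat_cons (p : formula) (e : nat -> V) f i :
  sat (fun n => app (scons f e n) i) p <-> sat (scons (app f i) (fun n => app (e n) i)) p.
Proof. apply sat_ext; intros [|n]; auto. Qed.

Lemma ae_sat_not (p : formula) (e : nat -> V) : (forall n, exists z, represents (e n) z) ->
  ~ ae (fun i => sat (fun n => app (e n) i) p) -> ae (fun i => ~ sat (fun n => app (e n) i) p).
Proof.
  intros H N; destruct (truth_definable p H) as (P & D & K).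
  apply (@ae_mono (fun i => ~ P i)); [intros i Hi A B; apply A, K; auto |].
  apply ae_not; auto; intros A; apply N; revert A; apply ae_mono; intros i Hi; apply K; auto.
Qed.

Lemma ae_witness (p : formula) (e : nat -> V) : (forall n, exists z, represents (e n) z) ->
  ae (fun i => exists y, sat (scons y (fun n => app (e n) i)) p) ->
  exists f z, represents f z /\ ae (fun i => sat (scons (app f i) (fun n => app (e n) i)) p).
Proof.
  intros H A; destruct (truth_definable2 p H) as (P & D & K).
  (* The implication makes the relation total: an index without a witness may take any value, here
     [i]. *)
  destruct (@choice_function V hV I (fun i y => (exists y', P i y') -> P i y)) as (f & T & B & C).
  - def.
  - intros i Hi; destruct (classic (exists y, P i y)) as [[y L] | N]; [exists y; auto |].
    exists i; tauto.
  - destruct (represents_exists B) as (z & Hz); exists f, z; split; auto.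
    revert A; apply ae_mono; intros i Hi [y L]; apply K, C; auto; exists y; apply K; auto.
Qed.

(** Łoś's theorem, by induction on [p]. Disjunction, implication and the universal case rely on the
    ultrafilter dichotomy [ae_sat_not]; quantifiers rely on choosing witnesses index by index. *)
Theorem los (p : formula) : forall (e : nat -> V) (E : nat -> submodel ultrapower),
  (forall n, represents (e n) (proj1_sig (E n))) ->
  (sat E p <-> ae (fun i => sat (fun n => app (e n) i) p)).
Proof.
  assert (ex : forall (e : nat -> V) (E : nat -> submodel ultrapower),
    (forall n, represents (e n) (proj1_sig (E n))) -> forall n, exists z, represents (e n) z) by eauto.
  assert (ext_e : forall (e : nat -> V) (E : nat -> submodel ultrapower) f (x : submodel ultrapower),
    represents f (proj1_sig x) -> (forall n, represents (e n) (proj1_sig (E n))) ->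
    forall n, represents (scons f e n) (proj1_sig (scons x E n))) by (intros e E f x A B [|n]; simpl; auto).
  induction p; intros e E H; assert (Hex := ex e E H); simpl.
  - apply (represents_mem (H m) (H n)).
  - rewrite <- (represents_eq (H m) (H n)); split; [congruence |].
    destruct (E m) as [x Hx], (E n) as [y Hy]; simpl; intros ->; f_equal; apply proof_irrelevance.
  - split; [tauto |]; intros A; destruct (ae_ex A); tauto.
  - rewrite (IHp1 e E H), (IHp2 e E H); split.
    + intros [A B]; apply (ae_and A B).
    + intros A; split; revert A; apply ae_mono; tauto.
  - rewrite (IHp1 e E H), (IHp2 e E H); split.
    + intros [A | A]; revert A; apply ae_mono; tauto.
    + intros A; apply NNPP; intros N.
      assert (B := ae_sat_not (p := p1) Hex ltac:(tauto)).
      assert (C := ae_sat_not (p := p2) Hex ltac:(tauto)).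
      revert A; apply (ae_contra (P := fun i => ~ sat (fun n => app (e n) i) p1 /\
        ~ sat (fun n => app (e n) i) p2)); [tauto | apply ae_and; auto].
  - rewrite (IHp1 e E H), (IHp2 e E H); split.
    + intros A; destruct (classic (ae (fun i => sat (fun n => app (e n) i) p1))) as [B | B].
      * generalize (A B); apply ae_mono; tauto.
      * generalize (ae_sat_not Hex B); apply ae_mono; tauto.
    + intros A B; generalize (ae_and A B); apply ae_mono; tauto.
  - split.
    + intros A; apply NNPP; intros N; apply (ae_sat_not (p := FAll p)) in N; auto.
      (* Counterexamples chosen at almost all indices form a function whose class refutes the
         universal formula in the ultrapower. *)
      destruct (@ae_witness (FImp p FFalse) e Hex) as (f & z & Hf & B).
      { revert N; apply ae_mono; simpl; intros i _ N; apply NNPP; intros K; apply N; intros y.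
        apply NNPP; intros L; apply K; exists y; auto. }
      specialize (A (exist _ z (ex_intro _ f Hf))).
      apply (IHp (scons f e)) in A; [| apply ext_e; auto].
      revert A; apply (ae_contra (P := fun i => ~ sat (scons (app f i) (fun n => app (e n) i)) p)); auto.
      intros i _ C K; apply C, sat_cons; auto.
    + intros A [z [f Hf]]; apply (IHp (scons f e)); [apply ext_e; auto |].
      revert A; apply ae_mono; intros i _ A; apply sat_cons, A.
  - split.
    + intros [[z [f Hf]] A]; apply (IHp (scons f e)) in A; [| apply ext_e; auto].
      revert A; apply ae_mono; intros i _ A; exists (app f i); apply sat_cons; auto.
    + intros A; destruct (ae_witness Hex A) as (f & z & Hf & B).
      exists (exist _ z (ex_intro _ f Hf)); apply (IHp (scons f e)); [apply ext_e; auto |].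
      revert B; apply ae_mono; intros i _ B; apply sat_cons; auto.
Qed.

Definition const x := lam hV I (fun _ => x).

Lemma mem_const x p : p ∈ const x <-> exists i, i ∈ I /\ p = opair i x.
Proof. unfold const; apply mem_lam; def. Qed.
Local Hint Resolve mem_const : fomem.

Lemma app_const x i : i ∈ I -> app (const x) i = x.
Proof. intros H; unfold const; rewrite app_lam; auto; def. Qed.

Lemma const_function x : is_function (const x) I (sing hV x).
Proof. apply lam_function; [def | intros; apply mem_sing; auto]. Qed.

Lemma embed_spec x : represents (const x) (epsilon (inhabits x) (represents (const x))).
Proof. apply epsilon_spec, (represents_exists (const_function x)). Qed.

Definition embed x : submodel ultrapower :=
  exist ultrapower _ (ex_intro (fun f => represents f _) (const x) (embed_spec x)).

Lemma embed_represents x : represents (const x) (proj1_sig (embed x)).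
Proof. apply embed_spec. Qed.

(** [embed] picks its value by [epsilon], but the value is unique, so the graph is the definable
    relation on the right. *)
Lemma embed_iff x y : proj1_sig (embed x) = y <-> represents (const x) y.
Proof.
  split; [intros <-; apply embed_represents |].
  intros H; apply (represents_eq (embed_represents x) H), ae_all; auto.
Qed.

Lemma embed_elementary : elementary embed.
Proof.
  intros p e; rewrite (@los p (fun n => const (e n)) (fun n => embed (e n)))
    by (intros n; apply embed_represents).
  assert (K : forall i, i ∈ I -> (sat e p <-> sat (fun n => app (const (e n)) i) p)).
  { intros i Hi; apply sat_ext; intros n; rewrite app_const; auto. }
  split.
  - intros A; apply ae_all; intros i Hi; apply (K i Hi); auto.
  - intros A; destruct (ae_ex A) as (i & Hi & B); apply (K i Hi); auto.
Qed.

Lemma embed_definable : definable_embedding embed.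
Proof.
  split; [unfold ultrapower; def | split; [| apply embed_elementary]].
  assert (D : definable2 (fun x y => represents (const x) y)) by def.
  destruct D as (p & e & D); exists p, e; intros x y; rewrite embed_iff; auto.
Qed.

(** Induction on [x]. If an element of the image, the class of [g], differed from every y in [x],
    completeness would make [g] avoid all of [x] almost everywhere, while its values lie in [x]
    almost everywhere. *)
Lemma embed_fixes x : x ∈ l -> proj1_sig (embed x) = x.
Proof.
  intros Hx; rewrite embed_iff; assert (Ol : ordinal l) by apply Hl.
  assert (Ox := ordinal_mem Ol Hx); revert x Ox Hx.
  apply (@ordinal_ind V hV (fun x => x ∈ l -> represents (const x) x)); [def |].
  intros x Ox IH Hx; assert (E := embed_represents x).
  assert (Z : proj1_sig (embed x) = x).
  2:{ rewrite Z in E; auto. }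
  apply (ext hV); intros u; split.
  - intros A; destruct (represents_elem E A) as (g & Hg).
    apply (represents_mem Hg E) in A; apply NNPP; intros N.
    assert (B : ae (fun i => forall y, y ∈ x -> app g i <> y)).
    { apply (@ae_all_lt x (fun y i => app g i <> y)); auto; [def |].
      intros y Hy; apply ae_not; [def |]; intros B.
      assert (Hyl : y ∈ l) by (apply (ordinal_trans Ol Hx Hy)).
      apply N; replace u with y; auto; symmetry.
      apply (represents_eq Hg (IH y Hy Hyl)); revert B; apply ae_mono.
      intros i Hi; rewrite app_const; auto. }
    revert A; apply (ae_contra (P := fun i => forall y, y ∈ x -> app g i <> y)); auto.
    intros i Hi C D; rewrite app_const in D by auto; apply (C _ D); auto.
  - intros A; apply (represents_mem (IH u A (ordinal_trans Ol Hx A)) E), ae_all.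
    intros i Hi; rewrite !app_const; auto.
Qed.

Lemma card_lt_expressible : expressible2 (fun S (a c : S) => card_lt a c).
Proof. expr. Qed.

Theorem ultrapower_compact k o : uncountable_cardinal k -> ord_le l k -> ordinal o -> ord_le k o ->
  (forall i, i ∈ I -> card_lt i k) -> (forall b, b ∈ o -> ae (fun i => b ∈ i)) ->
  strongly_compact_up_to l k o.
Proof.
  intros Hk lk Oo ko Hc Hf.
  do 5 (split; [assumption |]).
  exists ultrapower, embed; split; [apply ultrapower_transitive |].
  split; [apply embed_definable |].
  set (id := lam hV I (fun i => i)).
  assert (Hid : is_function id I I) by (apply lam_function; auto; def).
  assert (aid : forall i, i ∈ I -> app id i = i) by (intros i Hi; unfold id; rewrite app_lam; auto; def).
  assert (exD : exists D : submodel ultrapower, represents id (proj1_sig D)).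
  { destruct (represents_exists Hid) as (z & Hz); exists (exist ultrapower z (ex_intro _ id Hz)); auto. }
  destruct exD as (D & Hz).
  assert (HD : forall x, x ∈ o -> embed x ∈ D).
  { intros x Hx; apply (represents_mem (embed_represents x) Hz).
    generalize (Hf x Hx); apply ae_mono; intros i Hi; rewrite app_const, aid; auto. }
  assert (LD : card_lt D (embed k)).
  { destruct card_lt_expressible as (p & Hp).
    apply (Hp _ (scons D (fun _ => embed k))).
    apply (@los p (scons id (fun _ => const k))).
    - intros [|n]; simpl; auto; apply embed_represents.
    - apply ae_all; intros i Hi; apply (Hp V (fun n => app (scons id (fun _ => const k) n) i)).
      simpl; rewrite app_const, aid; auto. }
  split; [| exists D; auto].
  assert (Ok : ordinal k) by apply Hk.
  (* An embedding that fixed all ordinals would give [embed k] = [k], contained in [D], which is too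
     small for that. The least moved ordinal is then the critical point. *)
  assert (mv : exists c, ordinal c /\ ~ represents (const c) c).
  { apply NNPP; intros N.
    assert (fx : forall c, ordinal c -> proj1_sig (embed c) = c).
    { intros c Oc; apply embed_iff, NNPP; intros K; apply N; eauto. }
    apply (card_lt_not_subset_sub hV embed_elementary (a := D) (c := embed k)); auto.
    - apply (transfer_cardinal embed_elementary (proj1 Hk)).
    - intros [x Hx] A; change (x ∈ proj1_sig (embed k)) in A; change (x ∈ proj1_sig D).
      rewrite (fx k Ok) in A; rewrite <- (fx x (ordinal_mem Ok A)).
      apply HD, (mem_ord_le Oo A ko). }
  destruct mv as (c0 & Oc0 & N).
  destruct (@ordinal_least V hV (fun c => ~ represents (const c) c) c0) as (c & Oc & Nc & Lc); auto.
  { def. }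
  exists c; split; [split; [auto | split] |].
  - intros A; apply Nc, embed_iff; auto.
  - intros x Hx; apply embed_iff, NNPP; intros K; apply (Lc x Hx K).
  - apply (ordinal_not_mem hV (proj1 (proj1 Hl)) Oc); intros A; apply Nc, embed_iff, embed_fixes; auto.
Qed.
End Ultrapower.

(** * Ultrafilters derived from embeddings *)

Section Derived.
Variables (V : structure) (hV : ZFC V) (l : V) (M : V -> Prop) (j : V -> submodel M).
Hypotheses (Hl : uncountable_cardinal l) (HM : transitive_class M) (Hj : definable_embedding j)
  (Hcrit : exists c, critical_point j c /\ ord_le l c).

Let el : elementary j := proj2 (proj2 Hj).

Lemma crit_fixes x : x ∈ l -> proj1_sig (j x) = x.
Proof. destruct Hcrit as (c & (Oc & _ & H) & L); intros Hx; apply H, (mem_ord_le Oc Hx L). Qed.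

Lemma crit_fixes_eq x (y : submodel M) : x ∈ l -> proj1_sig y = x -> y = j x.
Proof.
  intros Hx E; apply (submodel_ext hV HM); intros z; simpl; rewrite E, (crit_fixes Hx); tauto.
Qed.

(** Enumerate [s] along some [d] < [l]. The image of the enumeration is indexed by [j d] = [d], and
    each index is fixed, so every value is the image of a value. *)
Lemma small_image s (y : submodel M) : card_lt s l -> y ∈ j s -> exists x, x ∈ s /\ y = j x.
Proof.
  intros (d & [_ E] & Hd) Hy; apply (equinumerous_sym hV) in E; destruct E as (g & G).
  apply (bijection_iff hV) in G; destruct G as (F & _ & S).
  assert (A : forall y, y ∈ s -> exists x, x ∈ d /\ maps g x y).
  { intros z Hz; destruct (S z Hz) as (x & Hx & <-); exists x; split; auto.
    apply (function_maps hV F); auto. }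
  transport A (proj1 (transfer3 el (Phi := fun (S : structure) (s d g : S) =>
    forall y, y ∈ s -> exists x, x ∈ d /\ maps g x y)
    ltac:(expr) s d g)).
  destruct (A y Hy) as (x & Hx & K).
  change (proj1_sig x ∈ proj1_sig (j d)) in Hx; rewrite (crit_fixes Hd) in Hx.
  assert (Hxl := ordinal_trans (proj1 (proj1 Hl)) Hd Hx).
  rewrite (crit_fixes_eq Hxl eq_refl) in K; set (x0 := proj1_sig x) in *.
  assert (B : forall x y y', maps g x y -> maps g x y' -> y = y').
  { intros u v v'; rewrite !(maps_iff hV), !(function_mem hV F); intros [_ ->] [_ ->]; auto. }
  transport B (proj1 (transfer1 el (Phi := fun (S : structure) (g : S) =>
    forall x y y', maps g x y -> maps g x y' -> y = y')
    ltac:(expr) g)).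
  exists (app hV g x0); split; [apply (function_app hV F Hx) |].
  apply (B _ _ _ K).
  apply (transfer_maps el), (function_maps hV F); auto.
Qed.

(** The ultrafilter with seed [q]. The detour through [y] refers to the graph of [j], the form in
    which [j] is definable. *)
Definition derived I (q : submodel M) : V :=
  sep hV (power hV I) (fun a => exists y, proj1_sig (j a) = y /\ proj1_sig q ∈ y).

Lemma mem_derived I (q : submodel M) a : a ∈ derived I q <-> subset a I /\ q ∈ j a.
Proof.
  unfold derived; rewrite mem_sep, mem_power.
  - simpl; split; intros [A B]; split; auto; [destruct B as (y & <- & B) |]; eauto.
  - assert (D := proj1 (proj2 Hj)); set (J := fun x y => proj1_sig (j x) = y) in D.
    set (q0 := proj1_sig q); change (definable1 (fun a => exists y, J a y /\ q0 ∈ y)).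
    clearbody J q0; def.
Qed.

Lemma derived_ultrafilter I (q : submodel M) : q ∈ j I -> ultrafilter_over I (derived I q).
Proof.
  intros Hq; split; [| split; [| split; [| split; [| split]]]].
  - intros a A; apply mem_derived in A; tauto.
  - apply mem_derived; split; auto; intros x; auto.
  - intros a A B; apply mem_derived in B; destruct B as [_ B]; revert q Hq B.
    cut (is_empty (j a)); [intros H q _; apply H |].
    revert A; apply (proj1 (transfer1 el (Phi := fun (S : structure) (a : S) => is_empty a) ltac:(expr) a)).
  - intros a b A B C; apply mem_derived in A; apply mem_derived; split; auto.
    apply (transfer_subset el B); tauto.
  - intros a b c A B C; apply mem_derived in A; apply mem_derived in B; apply mem_derived.
    split; [intros x D; apply C in D; apply A; tauto |].
    transport C (proj1 (transfer3 el (Phi := fun (S : structure) (a b c : S) =>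
      forall x, x ∈ c <-> x ∈ a /\ x ∈ b)
    ltac:(expr) a b c)).
    apply C; tauto.
  - intros a b A B; rewrite !mem_derived.
    assert (S : subset b I) by (intros x C; apply B in C; tauto).
    transport B (proj1 (transfer3 el (Phi := fun (S : structure) (a b d : S) =>
      forall x, x ∈ b <-> x ∈ d /\ ~ x ∈ a)
    ltac:(expr) a b I)).
    destruct (classic (q ∈ j a)) as [C | C]; auto; right; split; auto; apply B; auto.
Qed.

(** By [small_image], [j s] contains only images of members of [s], and the seed lies in each of
    these. *)
Lemma derived_complete I (q : submodel M) : q ∈ j I -> complete_over l I (derived I q).
Proof.
  intros Hq s S L b B; apply mem_derived; split; [intros x C; apply B in C; tauto |].
  transport B (proj1 (transfer3 el (Phi := fun (S : structure) (b d s : S) =>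
    forall x, x ∈ b <-> x ∈ d /\ forall a, a ∈ s -> x ∈ a)
    ltac:(expr) b I s)).
  apply B; split; auto; intros y Hy; destruct (small_image L Hy) as (x & Hx & ->).
  apply S, mem_derived in Hx; tauto.
Qed.

(** * What a bound for the image of the cofinality yields *)

Section Bound.
Variables (k d : V) (b : submodel M).
Hypotheses (Hk : uncountable_cardinal k) (Hcof : has_cofinality k d) (Hb : b ∈ j d)
  (Hbound : forall x, x ∈ d -> j x ∈ b).

Lemma bound_measurable : measurable l d.
Proof.
  destruct Hk as (Ck & w & Hw & wk); destruct Hl as (Cl & w' & Hw' & wl).
  assert (Cd : cardinal d) by apply (cofinality_cardinal hV Hw Ck wk Hcof).
  assert (Od : ordinal d) by apply Cd.
  assert (ld : ord_le l d).
  (* If [d] < [l], then [b] is an element of [j d] = [d], hence fixed, and the bound gives [b] ∈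
     [b]. *)
  { apply (ordinal_not_mem hV (proj1 Cl) Od); intros A.
    assert (B : proj1_sig b ∈ d) by (rewrite <- (crit_fixes A); apply Hb).
    assert (C := Hbound B); rewrite <- (crit_fixes_eq (ordinal_trans (proj1 Cl) A B) eq_refl) in C.
    apply (mem_irrefl hV C). }
  split; [auto |]; split; [split; auto; exists w'; split; auto; apply (mem_ord_le Od wl ld) |].
  split; [auto |]; split; [auto |]; split; [right; auto |].
  exists M, j; split; [auto |]; split; [auto |]; split; [auto |].
  exists b; split; auto.
  assert (A : forall c x : V, cardinal c -> x ∈ c -> card_lt x c).
  { intros c x Cc Hx; apply (injects_card_lt (hV := hV) (proj1 Cc) Hx), injects_subset.
    intros z; auto. }
  transport A (transfer hV el (Phi := fun S : structure => forall c x : S,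
    cardinal c -> x ∈ c -> card_lt x c) ltac:(expr)).
  apply A; auto.
  apply (transfer_cardinal el Cd).
Qed.

Lemma bound_ultrafilter : exists U, ultrafilter_over d U /\ complete_over l d U /\ uniform_over d U.
Proof.
  destruct Hk as (Ck & w & Hw & wk).
  exists (derived d b); split; [apply (derived_ultrafilter Hb) |].
  split; [apply (derived_complete Hb) |].
  intros a A; apply mem_derived in A; destruct A as [S A].
  (* If [a] were contained in [y], then [b] ∈ [j a] would lie in [j y], against [j y] ∈ [b]. *)
  apply (unbounded_cardinality hV Hw Ck wk Hcof S); intros y Hy T.
  apply (transfer_subset el) in T.
  apply (mem_asym hV (Hbound Hy) (T b A)).
Qed.
End Bound.
End Derived.

(** * Covering ultrafilters *)

Section Covering.
Variables (V : structure) (hV : ZFC V) (l : V).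
Hypothesis Hl : uncountable_cardinal l.

(* A first-order counterpart of [strongly_compact_up_to l k o], which quantifies over
   classes and so cannot occur in an instance of replacement. *)
Definition covering_ultrafilter k o : Prop :=
  exists I U : V, ultrafilter_over I U /\ complete_over l I U /\
    (forall i, i ∈ I -> card_lt i k) /\
    forall b, b ∈ o -> exists a, a ∈ U /\ forall i, i ∈ a -> b ∈ i.

Lemma covering_definable : definable2 covering_ultrafilter.
Proof. unfold covering_ultrafilter; def. Qed.

Lemma covering_mono k o o' : subset o' o -> covering_ultrafilter k o -> covering_ultrafilter k o'.
Proof. intros S (I & U & A & B & C & D); exists I, U; auto 6. Qed.

(** The seed is the intersection of [D] with [j o], trimmed in this way to be an element of [j I].
    That it contains [j b] says exactly that the sets containing [b] have measure one. *)
Lemma covering_of_embedding k o (M : V -> Prop) (j : V -> submodel M) (D : submodel M) :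
  transitive_class M -> definable_embedding j -> (exists c, critical_point j c /\ ord_le l c) ->
  cardinal k -> (forall x, x ∈ o -> j x ∈ D) -> card_lt D (j k) -> covering_ultrafilter k o.
Proof.
  intros HM Hj Hc Ck HD LD; assert (el : elementary j) by apply Hj.
  (* The intersection must be formed inside [M], so its existence is transferred too. *)
  assert (A : forall a b : V, exists c, forall x, x ∈ c <-> x ∈ a /\ x ∈ b).
  { intros a b; exists (sep hV a (fun x => x ∈ b)); intros x; rewrite mem_sep; [tauto | def]. }
  transport A (transfer hV el (Phi := fun S : structure => forall a b : S, exists c,
    forall x, x ∈ c <-> x ∈ a /\ x ∈ b) ltac:(expr)).
  destruct (A D (j o)) as (q & Hq).
  set (I := sep hV (power hV o) (fun x => card_lt x k)).
  assert (mI : forall x, x ∈ I <-> subset x o /\ card_lt x k).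
  { intros x; unfold I; rewrite mem_sep, mem_power; [tauto | def]. }
  assert (HqI : q ∈ j I).
  { assert (B := mI).
    transport B (proj1 (transfer3 el (Phi := fun (S : structure) (I o k : S) =>
      forall x, x ∈ I <-> subset x o /\ card_lt x k)
    ltac:(expr) I o k)).
    apply B; split; [intros x C; apply Hq in C; tauto |].
    assert (E : forall a b c : V, cardinal c -> subset a b -> card_lt b c -> card_lt a c).
    { intros a b c Cc S; apply (card_lt_mono (hV := hV) (proj1 Cc)), injects_subset; auto. }
    transport E (transfer hV el (Phi := fun S : structure => forall a b c : S,
      cardinal c -> subset a b -> card_lt b c -> card_lt a c) ltac:(expr)).
    apply (E q D); auto; [| intros x C; apply Hq in C; tauto].
    apply (transfer_cardinal el Ck). }
  exists I, (derived hV j I q); split; [apply derived_ultrafilter; auto |].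
  split; [apply derived_complete; auto |].
  split; [intros i Hi; apply mI in Hi; tauto |].
  intros b Hb; set (a := sep hV I (fun i => b ∈ i)).
  assert (ma : forall i, i ∈ a <-> i ∈ I /\ b ∈ i) by (intros i; unfold a; rewrite mem_sep; [tauto | def]).
  exists a; split; [| intros i Hi; apply ma in Hi; tauto].
  apply mem_derived; auto; split; [intros i Hi; apply ma in Hi; tauto |].
  transport ma (proj1 (transfer3 el (Phi := fun (S : structure) (a I b : S) =>
    forall i, i ∈ a <-> i ∈ I /\ b ∈ i)
    ltac:(expr) a I b)).
  apply ma; split; auto; apply Hq; split; auto.
  apply (transfer_mem el); auto.
Qed.

Lemma compact_of_covering k : uncountable_cardinal k -> ord_le l k ->
  (forall o, ordinal o -> covering_ultrafilter k o) -> strongly_compact l k.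
Proof.
  intros Hk lk H; split; [auto |]; split; [auto |]; split; [auto |].
  intros o Oo ko; destruct (H o Oo) as (I & U & A & B & C & D).
  apply (ultrapower_compact hV Hl A B); auto.
Qed.
End Covering.

(** * The cofinality of the least strongly compact cardinal *)

Section Main.
Variables (V : structure) (hV : ZFC V) (l k d : V).
Hypotheses (Hl : uncountable_cardinal l) (Hk : uncountable_cardinal k) (lk : ord_le l k)
  (Hcof : has_cofinality k d).

Variables (M : V -> Prop) (j : V -> submodel M) (D : submodel M) (o : V).
Hypotheses (HM : transitive_class M) (Hj : definable_embedding j)
  (Hcrit : exists c, critical_point j c /\ ord_le l c)
  (Oo : ordinal o) (ko : ord_le k o) (HD : forall x, x ∈ o -> j x ∈ D) (LD : card_lt D (j k)).

Let el : elementary j := proj2 (proj2 Hj).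

Lemma cover_k x : x ∈ k -> j x ∈ D.
Proof. intros Hx; apply HD, (mem_ord_le Oo Hx ko). Qed.

Lemma regular_bound : d = k -> exists b, b ∈ j d /\ forall x, x ∈ d -> j x ∈ b.
Proof.
  intros E; assert (A : forall w k s : V, is_omega w -> cardinal k -> w ∈ k -> has_cofinality k k ->
    card_lt s k -> exists y, y ∈ k /\ forall x, x ∈ s -> x ∈ k -> x ∈ y) by apply (regular_bounded hV).
  transport A (transfer hV el (Phi := fun S : structure => forall w k s : S, is_omega w -> cardinal k ->
    w ∈ k -> has_cofinality k k -> card_lt s k ->
    exists y, y ∈ k /\ forall x, x ∈ s -> x ∈ k -> x ∈ y) ltac:(expr)).
  destruct Hk as (Ck & w & Hw & wk); subst d.
  destruct (A (j w) (j k) D) as (b & Hb & B); auto.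
  - apply (proj1 (transfer1 el (Phi := fun (S : structure) (w : S) => is_omega w) ltac:(expr) w) Hw).
  - apply (transfer_cardinal el Ck).
  - apply (transfer_mem el); auto.
  - apply (proj1 (transfer1 el (Phi := fun (S : structure) (c : S) => has_cofinality c c) ltac:(expr) k) Hcof).
  - exists b; split; auto; intros x Hx; apply B; [apply cover_k; auto | apply (transfer_mem el); auto].
Qed.

Hypothesis continuous : forall b, b ∈ j d -> exists x, x ∈ d /\ ~ j x ∈ b.

(** The monotone cofinal map [G] from [d] to [k] is moved to one from [j d] to [j k]. Its value at
    some [x] exceeds [m]; by continuity [x] is at most some [j y], and the value there is the image
    of [below hV f y]. *)
Lemma continuous_below (m : submodel M) : m ∈ j k -> exists y, y ∈ k /\ m ∈ j y.
Proof.
  intros Hm; destruct Hk as (Ck & w & Hw & wk).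
  assert (Hcof' := Hcof); destruct Hcof' as (Od & (f & F) & _).
  set (G := lam hV d (below hV f)).
  assert (DG : definable2 (fun x y => y = below hV f x)) by def.
  assert (HG : is_function G d k).
  { apply lam_function; auto; intros x; apply (below_mem hV Ck Hcof F). }
  assert (mG : forall x z, x ∈ d -> (maps G x z <-> z = below hV f x)).
  { intros x z Hx; rewrite (function_maps hV HG) by auto; unfold G; rewrite app_lam; auto; tauto. }
  assert (A : forall y, y ∈ k -> exists x z, x ∈ d /\ maps G x z /\ y ∈ z).
  { intros y Hy; destruct (below_cofinal hV Hw Ck wk Hcof F Hy) as (x & Hx & B).
    exists x, (below hV f x); rewrite mG; auto. }
  transport A (proj1 (transfer3 el (Phi := fun (S : structure) (k d G : S) =>
    forall y, y ∈ k -> exists x z, x ∈ d /\ maps G x z /\ y ∈ z)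
    ltac:(expr) k d G)).
  (* The order is written [~ x' ∈ x], the form in which [continuous] compares [x] with [j y], so no
     comparability of ordinals is needed in [M]. *)
  assert (B : forall x x' z z', x ∈ d -> x' ∈ d -> ~ x' ∈ x -> maps G x z -> maps G x' z' -> subset z z').
  { intros x x' z z' Hx Hx' N; rewrite !mG by auto; intros -> ->.
    apply (below_mono (hV := hV) Hcof Hx Hx').
    apply (ordinal_not_mem hV (ordinal_mem Od Hx) (ordinal_mem Od Hx') N). }
  transport B (proj1 (transfer2 el (Phi := fun (S : structure) (d G : S) => forall x x' z z', x ∈ d -> x' ∈ d ->
    ~ x' ∈ x -> maps G x z -> maps G x' z' -> subset z z')
    ltac:(expr) d G)).
  destruct (A m Hm) as (x & z & Hx & Mz & Hz); destruct (continuous Hx) as (y & Hy & N).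
  exists (below hV f y); split; [apply (below_mem hV Ck Hcof F Hy) |].
  apply (B x (j y) z (j (below hV f y)) Hx); auto.
  - apply (transfer_mem el); auto.
  - apply (transfer_maps el), mG; auto.
Qed.

(** If [l] = [k], every element of [j k] lies in some [j y] = [y] with [y] < [k]; it is thus fixed
    and belongs to [D], so [D] would contain all of [j k]. *)
Lemma continuous_above_critical : l ∈ k.
Proof.
  destruct lk as [A | E]; auto; exfalso; subst l.
  apply (card_lt_not_subset_sub hV el (a := D) (c := j k)); auto.
  - apply (transfer_cardinal el (proj1 Hk)).
  - intros m Hm; destruct (continuous_below Hm) as (y & Hy & A).
    change (proj1_sig m ∈ proj1_sig (j y)) in A; rewrite (crit_fixes Hcrit Hy) in A.
    assert (B := ordinal_trans (proj1 (proj1 Hk)) Hy A).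
    rewrite (crit_fixes_eq hV HM Hcrit B eq_refl); apply cover_k; auto.
Qed.

Lemma continuous_covering : d ∈ k ->
  exists x, x ∈ k /\ uncountable_cardinal x /\ ord_le l x /\ covering_ultrafilter l x o.
Proof.
  intros Hd; destruct Hk as (Ck & w & Hw & wk).
  assert (Hcof' := Hcof); destruct Hcof' as (_ & (f & F) & _).
  destruct LD as (e & He & ek); destruct (continuous_below ek) as (y & Hy & ey).
  assert (Ok : ordinal k) by apply Ck.
  assert (lk' := continuous_above_critical).
  (* Above [l], so that [x] is uncountable and at least [l]; above [y], so that the cardinality [e]
     ∈ [j y] of [D] is below [j x]. *)
  destruct (limit_of_cardinals hV Hw Ck wk F Hd (a := cup hV l y)) as (x & Hx & A & Cx).
  { apply cup_mem; auto. }
  assert (Ol := ordinal_mem Ok lk'); assert (Oy := ordinal_mem Ok Hy).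
  assert (lx := ord_le_mem (proj1 Cx) (ord_le_cup_l hV Ol Oy) A).
  assert (yx := ord_le_mem (proj1 Cx) (ord_le_cup_r hV Ol Oy) A).
  exists x; split; [auto |]; split; [| split; [left; auto |]].
  - split; auto; destruct Hl as (_ & w' & Hw' & wl); exists w'; split; auto.
    apply (ordinal_trans (proj1 Cx) lx wl).
  - apply (covering_of_embedding hV Hl HM Hj Hcrit Cx HD).
    exists e; split; auto.
    assert (T : transitive_set (j x)).
    { apply (proj1 (transfer1 el (Phi := fun (S : structure) (c : S) => transitive_set c) ltac:(expr) x)).
      exact (proj1 (proj1 Cx)). }
    apply (T (j y)); auto; apply (transfer_mem el); auto.
Qed.
End Main.

Theorem proposition4p7 (V : structure) (hV : ZFC V) (lambda kappa delta : V)
  (hlambda : uncountable_cardinal lambda)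
  (hkappa : least_strongly_compact lambda kappa)
  (hdelta : has_cofinality kappa delta) :
  measurable lambda delta /\
  exists U : V,
    ultrafilter_over delta U /\ complete_over lambda delta U /\
    uniform_over delta U.
Proof.
  destruct hkappa as ((_ & Hk & lk & SC) & least).
  assert (Ok : ordinal kappa) by apply Hk.
  apply NNPP; intros N.
  assert (cov : forall o, ordinal o -> ord_le kappa o -> exists x, x ∈ kappa /\
    uncountable_cardinal x /\ ord_le lambda x /\ covering_ultrafilter lambda x o).
  { intros o Oo ko.
    destruct (SC o Oo ko) as (_ & _ & _ & _ & _ & M & j & HM & Hj & Hc & D & HD & LD).
    assert (cont : ~ exists b, b ∈ j delta /\ forall x, x ∈ delta -> j x ∈ b).
    { intros (b & Hb & B); apply N; split.
      - apply (bound_measurable hV hlambda HM Hj Hc Hk hdelta Hb B).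
      - apply (bound_ultrafilter hV hlambda HM Hj Hc Hk hdelta Hb B). }
    assert (dk : delta ∈ kappa).
    { destruct (cofinality_le hV (proj1 Hk) hdelta) as [A | A]; auto.
      destruct cont; apply (regular_bound hV Hk hdelta Hj Oo ko HD LD A). }
    apply (continuous_covering hV hlambda Hk lk hdelta HM Hj Hc Oo ko HD LD); auto.
    intros b Hb; apply NNPP; intros K; apply cont; exists b; split; auto.
    intros x Hx; apply NNPP; intros Q; apply K; eauto. }
  assert (dc := covering_definable lambda).
  (* Below [b] there is a failure of covering for each [x] < [kappa] that fails anywhere. *)
  destruct (@ordinal_bound V hV kappa (fun x o => ~ covering_ultrafilter lambda x o))
    as (b & Ob & Hb).
  { set (Q := covering_ultrafilter lambda) in *; clearbody Q; def. }
  (* The [x] that works at this ordinal works at all ordinals below [b], so it fails nowhere; it is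
     then strongly compact, and minimality gives [kappa] ≤ [x] ∈ [kappa]. *)
  destruct (cov (cup hV kappa b)) as (x & Hx & Ux & lx & Cx).
  { apply ordinal_cup; auto. } { apply ord_le_cup_l; auto. }
  apply (mem_irrefl hV (x := x)), (mem_ord_le (b := kappa)); auto; [apply Ux |].
  apply least, compact_of_covering; auto; intros o Oo; apply NNPP; intros K.
  destruct (Hb x Hx) as (a & Ha & Na); [eauto |].
  apply Na; revert Cx; apply covering_mono; intros z Hz; apply mem_cup; right.
  apply (ordinal_trans Ob Ha Hz).
Qed.
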